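(* Let $H:\mathbb{T}^n\times\mathbb{R}^n\to\mathbb{R}$ be smooth, $\mathbb{Z}^n$-periodic in $x$, such that (i) $H(x,\cdot)$ is strictly convex for every $x$, and (ii) $\lim_{|p|\to\infty} H(x,p)/|p|=+\infty$. Let $P\in\mathbb{R}^n$. Then a Borel probability measure $\nu$ on $\mathbb{T}^n\times\mathbb{R}^n$ is a minimizer of $$\min_{\nu\in\mathcal{F}}\int_{\mathbb{T}^n\times\mathbb{R}^n}\big(L(x,v)+P\cdot v\big)\,d\nu(x,v)$$ if and only if the measure $\mu=\Phi_{\#}\nu$ satisfies: (a) $\int H(x,p)\,d\mu(x,p)=\overline{H}(P)$ and $H(x,p)=\overline{H}(P)$ for $\mu$-a.e. $(x,p)$; (b) $\int (p-P)\cdot D_pH(x,p)\,d\mu(x,p)=0$; (c) $\int D_pH(x,p)\cdot D\phi(x)\,d\mu(x,p)=0$ for every $\phi\in C^1(\mathbb{T}^n)$.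
   Context: $\mathbb{T}^n=\mathbb{R}^n/\mathbb{Z}^n$. The Lagrangian is $L(x,v)=\sup_{p\in\mathbb{R}^n}\{-p\cdot v-H(x,p)\}$, and $\Phi:\mathbb{T}^n\times\mathbb{R}^n\to\mathbb{T}^n\times\mathbb{R}^n$ is $\Phi(x,v)=(x,-D_vL(x,v))$; $\Phi_\#\nu$ denotes the push-forward of $\nu$ by $\Phi$. $\mathcal{F}$ is the set of holonomic measures: Borel probability measures $\nu$ on $\mathbb{T}^n\times\mathbb{R}^n$ with $\int v\cdot D\psi(x)\,d\nu(x,v)=0$ for every $\psi\in C^1(\mathbb{T}^n)$. $\overline{H}(P)$ is the unique real number such that $H(x,P+Du(x))=\overline{H}(P)$ admits a $\mathbb{Z}^n$-periodic viscosity solution $u$. *)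

(* Defs.v *)
From HB Require Import structures.
From mathcomp Require Import all_boot all_order all_algebra.
From mathcomp Require Import all_classical all_reals all_analysis.
Set Implicit Arguments. Unset Strict Implicit. Unset Printing Implicit Defensive.
Import Order.TTheory GRing.Theory Num.Theory.
Import numFieldNormedType.Exports.
Local Open Scope classical_set_scope.
Local Open Scope ring_scope.

Definition rV_measure_display : measure_display -> measure_display.
Proof. exact. Qed.

Section rV_measurable.
Context (R : realType) (n : nat).
Let coord : 'I_n -> 'rV[R]_n -> R := fun i x => x ord0 i.
Let rV_set0 : g_sigma_preimage coord set0.
Proof. exact: sigma_algebra0. Qed.
Let rV_setC A : g_sigma_preimage coord A -> g_sigma_preimage coord (~` A).
Proof. exact: sigma_algebraC. Qed.
Let rV_bigcup (F : _^nat) : (forall i, g_sigma_preimage coord (F i)) ->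
  g_sigma_preimage coord (\bigcup_i (F i)).
Proof. exact: sigma_algebra_bigcup. Qed.
HB.instance Definition _ := @isMeasurable.Build
  (rV_measure_display default_measure_display)
  'rV[R]_n (g_sigma_preimage coord) rV_set0 rV_setC rV_bigcup.
End rV_measurable.


(* Conventions.  R^n is 'rV[R]_n (a normed module with the max norm; it      *)
(* carries above the Borel sigma-algebra, generated by the coordinates).    *)
(* Functions on the torus T^n are Z^n-periodic functions on R^n; measures   *)
(* on T^n x R^n are measures on R^n x R^n concentrated on [0,1)^n x R^n.     *)

Section defs.
Context {R : realType}.

Definition int_vec (n : nat) (k : 'I_n -> int) : 'rV[R]_n := \row_i (k i)%:~R.

Definition Zn_periodic (n : nat) (T : Type) (f : 'rV[R]_n -> T) : Prop :=
  forall (x : 'rV[R]_n) (k : 'I_n -> int), f (x + int_vec k) = f x.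

Definition unit_cube (n : nat) : set 'rV[R]_n :=
  [set x | forall i : 'I_n, 0 <= x ord0 i < 1].

Definition dotv (n : nat) (u v : 'rV[R]_n) : R := \sum_(i < n) u ord0 i * v ord0 i.

Definition grad (n : nat) (f : 'rV[R]_n -> R) (x : 'rV[R]_n) : 'rV[R]_n :=
  \row_i 'D_(delta_mx ord0 i) f x.

Fixpoint iter_derive (V : normedModType R) (vs : seq V) (g : V -> R) : V -> R :=
  if vs is v :: vs' then fun x => 'D_v (iter_derive vs' g) x else g.

Definition smooth (V : normedModType R) (g : V -> R) : Prop :=
  forall vs : seq V, continuous (iter_derive vs g) /\
    (forall x v : V, derivable (iter_derive vs g) x v).

Definition C1 (n : nat) (f : 'rV[R]_n -> R) : Prop :=
  continuous f /\
  forall i : 'I_n, (forall x, derivable f x (delta_mx ord0 i)) /\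
    continuous ('D_(delta_mx ord0 i) f).

Definition strictly_convex (n : nat) (f : 'rV[R]_n -> R) : Prop :=
  forall (p q : 'rV[R]_n) (t : R), p != q -> 0 < t < 1 ->
    f (t *: p + (1 - t) *: q) < t * f p + (1 - t) * f q.

Definition superlinear (n : nat) (f : 'rV[R]_n -> R) : Prop :=
  forall M : R, exists K : R, forall p : 'rV[R]_n, K < `|p| -> M < f p / `|p|.

Definition viscosity_solution (n : nat) (G : 'rV[R]_n -> 'rV[R]_n -> R) (c : R)
    (u : 'rV[R]_n -> R) : Prop :=
  continuous u /\
  (forall (phi : 'rV[R]_n -> R) (x0 : 'rV[R]_n), C1 phi ->
     (\forall y \near x0, u y - phi y <= u x0 - phi x0) -> G x0 (grad phi x0) <= c) /\
  (forall (phi : 'rV[R]_n -> R) (x0 : 'rV[R]_n), C1 phi ->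
     (\forall y \near x0, u x0 - phi x0 <= u y - phi y) -> c <= G x0 (grad phi x0)).

Definition is_effective_hamiltonian (n : nat) (H : 'rV[R]_n -> 'rV[R]_n -> R)
    (P : 'rV[R]_n) (c : R) : Prop :=
  exists u : 'rV[R]_n -> R, Zn_periodic u /\
    viscosity_solution (fun x p => H x (P + p)) c u.

Definition lagrangian (n : nat) (H : 'rV[R]_n -> 'rV[R]_n -> R) (x v : 'rV[R]_n) : R :=
  sup [set - dotv p v - H x p | p in [set: 'rV[R]_n]].

Definition Phi (n : nat) (H : 'rV[R]_n -> 'rV[R]_n -> R) (z : 'rV[R]_n * 'rV[R]_n) :
    'rV[R]_n * 'rV[R]_n :=
  (z.1, - grad (lagrangian H z.1) z.2).

Local Open Scope ereal_scope.

Definition torus_prob (n : nat) (nu : probability ('rV[R]_n * 'rV[R]_n)%type R) : Prop :=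
  nu (@unit_cube n `*` [set: 'rV[R]_n]) = 1.

Definition holonomic (n : nat) (nu : probability ('rV[R]_n * 'rV[R]_n)%type R) : Prop :=
  torus_prob nu /\
  forall psi : 'rV[R]_n -> R, Zn_periodic psi -> C1 psi ->
    \int[nu]_z (dotv z.2 (grad psi z.1))%:E = 0.

Definition action (n : nat) (H : 'rV[R]_n -> 'rV[R]_n -> R) (P : 'rV[R]_n)
    (nu : probability ('rV[R]_n * 'rV[R]_n)%type R) : \bar R :=
  \int[nu]_z (lagrangian H z.1 z.2 + dotv P z.2)%:E.

Definition is_minimizer (n : nat) (H : 'rV[R]_n -> 'rV[R]_n -> R) (P : 'rV[R]_n)
    (nu : probability ('rV[R]_n * 'rV[R]_n)%type R) : Prop :=
  holonomic nu /\
  forall nu' : probability ('rV[R]_n * 'rV[R]_n)%type R,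
    holonomic nu' -> action H P nu <= action H P nu'.

End defs.

(* Main.v *)
(* The minimal value of the action is [- Hbar_P]; the equivalence follows by
   looking at when the Fenchel inequality is saturated.

   Lower bound.  The sup-convolution of the periodic solution u followed by an
   inf-convolution (Lasry-Lions) gives periodic C^1 functions psi with
   H(x, P + D psi) <= Hbar + eps; integrating
   L + P.v >= - v.D psi - H(x, P + D psi) against a holonomic measure gives
   action >= - Hbar.

   Upper bound.  The inf-convolution of u is semiconcave and, at the minimising
   point y, u is touched from below by a paraboloid of slope p, so
   H(y, P + p) >= Hbar.  Euler steps with velocity - D_pH(y, P + p) give long
   polygonal curves of action close to - Hbar per unit time; once closed up on
   the torus they carry exactly holonomic measures.

   Equivalence.  If nu is minimal, the nonnegative functions
   L + P.v + v.D psi + Hbar + eps have integral eps.  They dominate both the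
   Fenchel gap at P + D psi(x) and Hbar + eps - H(x, P + D psi(x)), so P + D psi
   approaches the momentum - D_vL and H = Hbar holds almost everywhere.  Given
   that, condition (b) says that the action is - Hbar, and (c) that nu is
   holonomic. *)
Require Import Defs.
From HB Require Import structures.
From mathcomp Require Import all_boot all_order all_algebra.
From mathcomp Require Import ring lra.
From mathcomp Require Import all_classical all_reals all_analysis measurable_realfun.
Import Order.TTheory GRing.Theory Num.Theory.
Import numFieldNormedType.Exports.
Local Open Scope classical_set_scope.
Local Open Scope ring_scope.
Set Implicit Arguments. Unset Strict Implicit. Unset Printing Implicit Defensive.

(** * Vectors, continuity and periodic functions *)

(** No derivative of [u] is available: every use of the equation goes through a quadratic test
    function at an optimal point of a convolution, and the Lipschitz continuity of [u] is derived
    the same way. The functions psi depend on eps and no limit of their gradients is taken; the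
    level-set statement rests on a threshold for the gap at a fixed (x, v) that serves all psi with
    small eps. No limit of measures is taken either, near-minimal loops being enough for the upper
    bound. Their velocity comes from a choice of minimising point and may be discontinuous in x,
    which rules out a flow and dictates Euler steps. Integrability has to be earned before integrals
    can be added. It comes from the lower bound on L + P.v when the action is finite, and from
    [integral0_integrable] when an integral is 0. Sign convention: with L = sup(-p.v - H) the
    conjugate pair is v = -D_pH, p = -D_vL, so [Phi] sends v to the maximising p. *)

Section continuity.
Context {X Y Z : topologicalType}.

Lemma fst_cont : continuous (@fst X Y).
Proof. by move=> [x y]; exact: cvg_fst. Qed.

Lemma snd_cont : continuous (@snd X Y).
Proof. by move=> [x y]; exact: cvg_snd. Qed.

Lemma comp_cont (f : Y -> Z) (g : X -> Y) : continuous f -> continuous g ->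
  continuous (fun x => f (g x)).
Proof. by move=> cf cg x; exact: (cvg_comp _ _ (cg x) (cf (g x))). Qed.

Lemma pair_cont (f : X -> Y) (g : X -> Z) : continuous f -> continuous g ->
  continuous (fun x => (f x, g x)).
Proof. by move=> cf cg x; exact: (cvg_pair (cf x) (cg x)). Qed.

End continuity.

Section real_continuity.
Context {R : realType} {X : topologicalType}.
Implicit Types f g : X -> R.

Lemma add_cont f g : continuous f -> continuous g -> continuous (fun x => f x + g x).
Proof. by move=> cf cg x; apply: cvgD; [exact: cf|exact: cg]. Qed.

Lemma sub_cont f g : continuous f -> continuous g -> continuous (fun x => f x - g x).
Proof. by move=> cf cg x; apply: cvgB; [exact: cf|exact: cg]. Qed.

Lemma mul_cont f g : continuous f -> continuous g -> continuous (fun x => f x * g x).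
Proof. by move=> cf cg x; apply: cvgM; [exact: cf|exact: cg]. Qed.

Lemma opp_cont f : continuous f -> continuous (fun x => - f x).
Proof. by move=> cf x; apply: cvgN; exact: cf. Qed.

End real_continuity.

Section dot.
Context {R : realType} {n : nat}.
Local Notation V := 'rV[R]_n.
Implicit Types (u v w x y : V).

Lemma dotvC u v : dotv u v = dotv v u.
Proof. by apply: eq_bigr => i _; rewrite mulrC. Qed.

Lemma dotvDl u v w : dotv (u + v) w = dotv u w + dotv v w.
Proof. by rewrite /dotv -big_split; apply: eq_bigr => i _; rewrite mxE mulrDl. Qed.

Lemma dotvZl (k : R) u v : dotv (k *: u) v = k * dotv u v.
Proof. by rewrite /dotv mulr_sumr; apply: eq_bigr => i _; rewrite mxE mulrA. Qed.

Lemma dotvNl u v : dotv (- u) v = - dotv u v.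
Proof. by rewrite -scaleN1r dotvZl mulN1r. Qed.

Lemma dotvDr u v w : dotv w (u + v) = dotv w u + dotv w v.
Proof. by rewrite dotvC dotvDl !(dotvC w). Qed.

Lemma dotvZr (k : R) u v : dotv u (k *: v) = k * dotv u v.
Proof. by rewrite dotvC dotvZl dotvC. Qed.

Lemma dotvNr u v : dotv u (- v) = - dotv u v.
Proof. by rewrite dotvC dotvNl dotvC. Qed.

Lemma dotv0l v : dotv 0 v = 0.
Proof. by rewrite -(scale0r (0 : V)) dotvZl mul0r. Qed.

Lemma dotv0r v : dotv v 0 = 0.
Proof. by rewrite dotvC dotv0l. Qed.

Lemma dotv_delta v (i : 'I_n) : dotv v (delta_mx ord0 i) = v ord0 i.
Proof.
rewrite /dotv (bigD1 i)//= mxE !eqxx mulr1 big1 ?addr0// => j ji.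
by rewrite mxE eqxx (negbTE ji) mulr0.
Qed.

Definition dotvE := (dotvDl, dotvDr, dotvZl, dotvZr, dotvNl, dotvNr).

Lemma coord_le_norm v (i : 'I_n) : `|v ord0 i| <= `|v|.
Proof.
by rewrite [leRHS]/Num.norm/= mx_normrE; apply: (le_bigmax _ _ (ord0, i)).
Qed.

Lemma norm_le_coord v (r : R) : 0 <= r ->
  (forall i : 'I_n, `|v ord0 i| <= r) -> `|v| <= r.
Proof.
move=> r0 vr; rewrite [leLHS]/Num.norm/= mx_normrE; apply/bigmax_leP; split => //.
by move=> [i j] _ /=; rewrite (ord1 i).
Qed.

Lemma dotv_sqr_ge0 v : 0 <= dotv v v.
Proof. by apply: sumr_ge0 => i _; rewrite -expr2 sqr_ge0. Qed.

Lemma norm_sqr_le_dotv v : `|v| ^+ 2 <= dotv v v.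
Proof.
have h : `|v| <= Num.sqrt (dotv v v).
  apply: norm_le_coord => [|i]; first exact: sqrtr_ge0.
  rewrite -sqrtr_sqr ler_sqrt ?dotv_sqr_ge0// /dotv (bigD1 i)//= -expr2 lerDl.
  by apply: sumr_ge0 => j _; rewrite -expr2 sqr_ge0.
rewrite -(sqr_sqrtr (dotv_sqr_ge0 v)) ler_pXn2r ?nnegrE//.
Qed.

(** The norm is the max norm, hence the factor n in place of the Euclidean Cauchy-Schwarz
    inequality. *)
Lemma dotv_le_norm u v : `|dotv u v| <= n%:R * `|u| * `|v|.
Proof.
apply: (le_trans (ler_norm_sum _ _ _)).
apply: (@le_trans _ _ (\sum_(i < n) `|u| * `|v|)).
  by apply: ler_sum => i _; rewrite normrM ler_pM// coord_le_norm.
by rewrite sumr_const card_ord -[leLHS]mulr_natl mulrA.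
Qed.

Lemma dotv_sqr_le v : dotv v v <= n%:R * `|v| ^+ 2.
Proof. by rewrite expr2 mulrA (le_trans (ler_norm _))// dotv_le_norm. Qed.

Lemma norm_delta_le (i : 'I_n) : `|delta_mx ord0 i : V| <= 1.
Proof.
apply: norm_le_coord => // j; rewrite mxE eqxx/=.
by case: eqP => _; rewrite ?normr1 ?normr0.
Qed.

Lemma dotv_cvg (T : Type) (F : set_system T) (FF : Filter F)
    (f g : T -> V) (a b : V) : f @ F --> a -> g @ F --> b ->
  (fun t => dotv (f t) (g t)) @ F --> dotv a b.
Proof.
move=> fa gb; rewrite /dotv.
apply: cvg_big => [|i _].
  exact: add_continuous.
apply: cvgM.
  exact: (cvg_comp _ _ fa (@coord_continuous _ _ _ ord0 i a)).
exact: (cvg_comp _ _ gb (@coord_continuous _ _ _ ord0 i b)).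
Qed.

Lemma dotv_continuous (T : topologicalType) (f g : T -> V) :
  continuous f -> continuous g -> continuous (fun t => dotv (f t) (g t)).
Proof. by move=> cf cg t; apply: dotv_cvg; [exact: cf|exact: cg]. Qed.

Lemma rV_cvg (T : Type) (F : set_system T) (FF : Filter F)
    (f : T -> V) (a : V) : (forall i, (fun t => f t ord0 i) @ F --> a ord0 i) ->
  f @ F --> a.
Proof.
move=> fa; apply/cvgrPdist_le => e e0.
have H : forall i : 'I_n, \forall t \near F, `|a ord0 i - f t ord0 i| <= e.
  by move=> i; move/cvgrPdist_le : (fa i) => /(_ _ e0).
have := filter_forall FF H.
apply: filterS => t Ht; apply: norm_le_coord => [|i]; first exact: ltW.
by rewrite !mxE.
Qed.

Lemma rV_continuous (T : topologicalType) (f : T -> V) :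
  (forall i, continuous (fun t => f t ord0 i)) -> continuous f.
Proof. by move=> cf t; apply: (@rV_cvg _ (nbhs t)) => i; exact: cf. Qed.

Lemma norm_ball_compact (r : R) : compact [set v : V | `|v| <= r].
Proof.
apply: bounded_closed_compact.
  exists r; split; first exact: num_real.
  by move=> M rM v /= /le_trans; apply; exact: ltW.
apply: (@closed_comp _ _ (fun v : V => `|v|) [set x | x <= r]).
  by move=> v _; exact: norm_continuous.
exact: closed_le.
Qed.

Lemma norm_sphere_compact (p0 : V) (e : R) : compact [set p : V | `|p - p0| = e].
Proof.
apply: bounded_closed_compact.
  exists (`|p0| + e); split; first exact: num_real.
  move=> M M0 p /= pe; rewrite (le_trans _ (ltW M0))// -pe.
  by rewrite -{1}(subrK p0 p) addrC ler_normD.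
have cn : continuous (fun p : V => `|p - p0|).
  by move=> p; exact: (cvg_norm (cvgB (@cvg_id _ (nbhs p)) (cvg_cst p0))).
apply: (@closed_comp _ _ (fun p : V => `|p - p0|) [set x | x = e]).
  by move=> p _; exact: cn.
exact: closed_eq.
Qed.

End dot.
Arguments norm_ball_compact {R n} r.
Arguments norm_sphere_compact {R n} p0 e.

Lemma cont_max_ball (R : realType) (n : nat) (f : 'rV[R]_n -> R) (r : R) :
  0 <= r -> continuous f ->
  exists2 c, `|c| <= r & forall t, `|t| <= r -> f t <= f c.
Proof.
move=> r0 cf.
have [||c] := @compact_EVT_max _ _ f [set v | `|v| <= r] _ (norm_ball_compact r).
- by exists 0 => /=; rewrite normr0.
- exact: continuous_subspaceT.
by rewrite inE/= => cr H; exists c => // t tr; apply: H; rewrite inE.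
Qed.

(** * Functions on the torus: reduction to the unit cube *)

Section periodic.
Context {R : realType} {n : nat}.
Local Notation V := 'rV[R]_n.

Definition zfloor (x : V) : 'I_n -> int := fun i => Num.floor (x ord0 i).

Definition frac (x : V) : V := x - int_vec (zfloor x).

Lemma frac_coord x i : frac x ord0 i = x ord0 i - (Num.floor (x ord0 i))%:~R.
Proof. by rewrite !mxE. Qed.

Lemma frac_cube x : @unit_cube R n (frac x).
Proof.
move=> i; rewrite frac_coord subr_ge0 floor_le/=.
by rewrite ltrBlDr addrC -[X in _ + X](mulr1z 1) -intrD lt_succ_floor.
Qed.

Lemma cube_norm (x : V) : @unit_cube R n x -> `|x| <= 1.
Proof.
move=> Cx; apply: norm_le_coord => // i.
by have /andP[x0 x1] := Cx i; rewrite ger0_norm// ltW.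
Qed.

Lemma periodic_frac (T : Type) (f : V -> T) x : Zn_periodic f -> f (frac x) = f x.
Proof. by move=> pf; rewrite -{2}(subrK (int_vec (zfloor x)) x) pf. Qed.

Lemma periodic_frac_add (T : Type) (f : V -> T) x y : Zn_periodic f ->
  f (frac x + y) = f (x + y).
Proof.
move=> pf; rewrite -[in RHS](subrK (int_vec (zfloor x)) x).
by rewrite (addrAC (x - int_vec (zfloor x)) (int_vec (zfloor x)) y) pf.
Qed.

Lemma periodic_bounded (G : V * V -> R) : continuous G ->
  (forall p, Zn_periodic (fun x => G (x, p))) ->
  forall r : R, exists2 M : R, 0 <= M & forall x v, `|v| <= r -> `|G (x, v)| <= M.
Proof.
move=> cG pG r.
have cK : compact ([set x : V | `|x| <= 1] `*` [set v : V | `|v| <= r]).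
  by apply: compact_setX; exact: norm_ball_compact.
have bG : bounded_set (G @` ([set x | `|x| <= 1] `*` [set v | `|v| <= r])).
  by apply: compact_bounded; apply: continuous_compact => //; exact: continuous_subspaceT.
case: bG => M [_ MP]; exists (`|M| + 1) => [|x v vr]; first by rewrite addr_ge0.
rewrite -(periodic_frac x (pG v)).
apply: (MP (`|M| + 1)); first by rewrite (le_lt_trans (ler_norm M))// ltrDl.
exists (frac x, v) => //; split => //=.
exact/cube_norm/frac_cube.
Qed.

(** [frac] brings x into a compact set, but x + w may leave the cube; so the displacement w is
    quantified inside the near-covering property, and compactness provides one d for all base
    points. *)
Lemma periodic_unif (G : V * V -> R) : continuous G ->
  (forall p, Zn_periodic (fun x => G (x, p))) ->
  forall r e : R, 0 < e -> exists2 d : R, 0 < d &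
    forall x y v, `|x - y| <= d -> `|v| <= r -> `|G (x, v) - G (y, v)| <= e.
Proof.
move=> cG pG r e e0.
have cK : compact ([set x : V | `|x| <= 1] `*` [set v : V | `|v| <= r]).
  by apply: compact_setX; exact: norm_ball_compact.
have := (compact_near_coveringP _).1 cK R 0^'+
  (fun d z => forall w : V, `|w| <= d -> `|G (z.1, z.2) - G (z.1 + w, z.2)| <= e) _.
case.
  move=> [x v] _ /=.
  have e20 : 0 < e / 2 by rewrite divr_gt0.
  have /cvgrPdist_le/(_ _ e20) := cG (x, v).
  case=> -[A B] [/= nA nB] AB.
  have /nbhs_ballP[/= d d0 dA] := nA.
  exists ((ball x (d/2)) `*` B, [set t | t < d / 2]).
    split.
    - exists (ball x (d/2), B) => //=; split => //.
      by apply: nbhsx_ballx; rewrite divr_gt0.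
    - by apply: nbhs_right_lt; rewrite divr_gt0.
  move=> [[x' v'] t] /= [[x'x Bv'] td] w wt.
  have Ax' : A x' by apply: dA; apply: le_ball x'x; rewrite ler_pdivrMr// ler_pMr// ler1n.
  have Ax'w : A (x' + w).
    apply: dA; move: x'x; rewrite -!ball_normE/= => x'x.
    rewrite opprD addrA (le_lt_trans (ler_normB _ _))//.
    by rewrite (splitr d) ltrD// (le_lt_trans wt).
  have h1 := AB (x', v') (conj Ax' Bv').
  have h2 := AB (x' + w, v') (conj Ax'w Bv').
  move: h1 h2 => /=.
  rewrite !ler_norml => /andP[? ?] /andP[? ?]; lra.
move=> d0 /= d00 H.
exists (d0 / 2); first by rewrite divr_gt0.
move=> x y v xy vr.
rewrite -(periodic_frac x (pG v)) -(subrKC x y) -(periodic_frac_add x (y - x) (pG v)).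
have B2 : ball_ Num.norm (0 : R) d0 (d0 / 2).
  by rewrite /ball_/= sub0r normrN gtr0_norm ?divr_gt0// ltr_pdivrMr// ltr_pMr// ltr1n.
have d20 : 0 < d0 / 2 by rewrite divr_gt0.
have Kx : ([set x : V | `|x| <= 1] `*` [set v : V | `|v| <= r]) (frac x, v).
  by split => //=; exact/cube_norm/frac_cube.
by apply: (H _ B2 d20 _ Kx (y - x)); rewrite distrC.
Qed.

End periodic.

(** * Legendre duality *)

Section directional.
Context {R : realType} {V : normedModType R}.
Implicit Types (f : V -> R) (a e : V).

(** The limit of difference quotients multiplied out by h, so that h = 0 is harmless and estimates
    avoid division. *)
Definition slope_at f a e (l : R) := forall eps : R, 0 < eps ->
  exists2 d : R, 0 < d &
    forall h : R, `|h| < d -> `|f (a + h *: e) - f a - h * l| <= eps * `|h|.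

Lemma derivable_slope f a e : derivable f a e -> slope_at f a e ('D_e f a).
Proof.
move=> df eps e0.
have /cvgrPdist_le/(_ _ e0) : (fun h : R => h^-1 *: ((f \o shift a) (h *: e) - f a)) @ 0^' --> 'D_e f a by exact: df.
case=> d /= d0 H; exists d => // h hd.
have [->|h0] := eqVneq h 0.
  by rewrite scale0r addr0 subrr mul0r subr0 normr0 mulr0.
have := H h; rewrite /ball_/= sub0r normrN => /(_ hd h0).
rewrite (addrC _ a) => K.
have -> : f (a + h *: e) - f a - h * 'D_e f a =
  - (h * ('D_e f a - h^-1 *: (f (a + h *: e) - f a))).
  by rewrite /GRing.scale/=; field.
by rewrite normrN normrM mulrC ler_wpM2r.
Qed.

Lemma slope_derivable f a e l : slope_at f a e l -> derivable f a e /\ 'D_e f a = l.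
Proof.
move=> S.
have C : (fun h : R => h^-1 *: ((f \o shift a) (h *: e) - f a)) @ 0^' --> l.
  apply/cvgrPdist_le => eps e0; have [d d0 H] := S _ e0.
  exists d => //= h; rewrite /ball_/= sub0r normrN => hd h0.
  have hp : 0 < `|h| by rewrite normr_gt0.
  rewrite /= (addrC _ a) -(ler_pM2r hp) -normrM.
  have -> : (l - h^-1 *: (f (a + h *: e) - f a)) * h =
    - (f (a + h *: e) - f a - h * l).
    by rewrite /GRing.scale/=; field.
  by rewrite normrN H.
by split; [apply/cvg_ex; exists l|exact: cvg_lim].
Qed.

(** The lower bound holds for both signs of h: the increments at d/2 and -d/2 squeeze l against m
    from the two sides. *)
Lemma slope_unique_lower f a e (l m : R) : slope_at f a e l ->
  (forall h : R, h * m <= f (a + h *: e) - f a) -> l = m.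
Proof.
move=> S M.
suff H : forall eps, 0 < eps -> `|l - m| <= eps.
  apply/eqP; rewrite -subr_eq0 -normr_le0; apply/ler_addgt0Pl => eps e0.
  by rewrite addr0 H.
move=> eps e0; have [d d0 H] := S _ e0.
have d20 : 0 < d / 2 by rewrite divr_gt0.
have dd : d / 2 < d by rewrite ltr_pdivrMr// ltr_pMr// ltr1n.
have h1 := H (d / 2); have h2 := H (- (d / 2)).
move: h1 h2; rewrite normrN gtr0_norm// => /(_ dd) + /(_ dd).
have := M (d / 2); have := M (- (d / 2)).
rewrite !ler_norml => ? ? /andP[? ?] /andP[? ?].
have ? : (d/2) * (l - m) <= (d/2) * eps by lra.
have ? : (d/2) * (- eps) <= (d/2) * (l - m) by lra.
by apply/andP; split; rewrite -(ler_pM2l d20).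
Qed.

End directional.

Section legendre.
Context {R : realType} {n : nat}.
Local Notation V := 'rV[R]_n.
Variable H : V -> V -> R.
Hypothesis H_smooth : smooth (fun z : V * V => H z.1 z.2).
Hypothesis H_periodic : forall p : V, Zn_periodic (fun x => H x p).
Hypothesis H_convex : forall x : V, strictly_convex (H x).
Hypothesis H_superlinear : forall x : V, superlinear (H x).

Lemma H_cont : continuous (fun z : V * V => H z.1 z.2).
Proof. exact: (H_smooth [::]).1. Qed.

Lemma H_slope_uncurried (x p e : V) :
  slope_at (H x) p e ('D_((0, e) : V * V) (fun z : V * V => H z.1 z.2) (x, p)).
Proof.
move=> eps /(derivable_slope ((H_smooth [::]).2 (x, p) (0, e)))[d d0 K].
by exists d => // h /K /=; rewrite scaler0 addr0.
Qed.

Lemma gradH_coord (z : V * V) (i : 'I_n) : grad (H z.1) z.2 ord0 i =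
  'D_((0, delta_mx ord0 i) : V * V) (fun z : V * V => H z.1 z.2) z.
Proof.
case: z => x p; rewrite mxE; exact: (slope_derivable (@H_slope_uncurried x p _)).2.
Qed.

Lemma H_slope (x p : V) (i : 'I_n) :
  slope_at (H x) p (delta_mx ord0 i) (grad (H x) p ord0 i).
Proof. rewrite (gradH_coord (x, p)); exact: H_slope_uncurried. Qed.

Lemma gradH_cont : continuous (fun z : V * V => grad (H z.1) z.2).
Proof.
apply: rV_continuous => i.
under eq_fun do rewrite gradH_coord.
exact: (H_smooth [:: ((0, delta_mx ord0 i) : V * V)]).1.
Qed.

Lemma convexW x p q t : 0 <= t <= 1 ->
  H x (t *: p + (1 - t) *: q) <= t * H x p + (1 - t) * H x q.
Proof.
move=> /andP[t0 t1].
have [->|pq] := eqVneq p q.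
  by rewrite -scalerDl -mulrDl addrC subrK scale1r mul1r.
move: t0; rewrite le_eqVlt => /predU1P[<-|t0].
  by rewrite scale0r mul0r subr0 scale1r mul1r !add0r.
move: t1; rewrite le_eqVlt => /predU1P[->|t1].
  by rewrite subrr scale0r mul0r scale1r mul1r !addr0.
by apply/ltW/H_convex => //; rewrite t0 t1.
Qed.

Local Notation F x v p := (- dotv p v - H x p).

Lemma F_continuous (T : topologicalType) (x v p : T -> V) :
  continuous x -> continuous v -> continuous p ->
  continuous (fun t => F (x t) (v t) (p t)).
Proof.
move=> cx cv cp t; apply: cvgB; last exact: (comp_cont H_cont (pair_cont cx cp)).
by apply: cvgN; apply: dotv_continuous.
Qed.

Lemma F_max_exists x v : exists p, forall q, F x v q <= F x v p.
Proof.
have [K KP] := H_superlinear x (n%:R * `|v| + 1).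
(* The superlinearity slope n|v| + 1 absorbs the linear term: beyond [r], F x v q < -|q| < F x v 0,
   so a maximiser on the ball is global. *)
pose r := Num.max K 0 + `|F x v 0| + 1.
have m0 : 0 <= Num.max K 0 by rewrite le_max lexx orbT.
have mK : K <= Num.max K 0 by rewrite le_max lexx.
have r0 : 0 <= r by rewrite !addr_ge0.
have [|c cr cmax] := @cont_max_ball _ _ (fun p => F x v p) r r0.
  by apply: (@F_continuous V (fun=> x) (fun=> v) id); [exact: cst_continuous|exact: cst_continuous|move=> t; exact: cvg_id].
exists c => q; have [qr|qr] := leP `|q| r; first exact: cmax.
have F0c : F x v 0 <= F x v c by apply: cmax; rewrite normr0.
apply: le_trans F0c.
have q0 : 0 < `|q| by apply: le_lt_trans qr.
have Kq : K < `|q|.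
  by apply: le_lt_trans qr; rewrite /r -addrA ler_wpDr// addr_ge0.
have := KP _ Kq; rewrite ltr_pdivlMr// => Hq.
have := dotv_le_norm q v; rewrite ler_norml => /andP[dq _].
have := ler_norm (- F x v 0); rewrite normrN => N0.
have E : n%:R * `|q| * `|v| = n%:R * `|v| * `|q| by rewrite mulrAC.
have : Num.max K 0 + `|F x v 0| + 1 < `|q| by [].
rewrite E in dq. lra.
Qed.

(** The maximiser in the Legendre transform, which turns out to be -D_vL. The default 0 is never a
    fallback, by [F_max_exists]. *)
Definition momentum x v : V := xget 0 [set p | forall q, F x v q <= F x v p].

Lemma momentumP x v q : F x v q <= F x v (momentum x v).
Proof.
by rewrite /momentum; case: xgetP => [p _ /(_ q)//|/(_ _) N]; have [p /N] := F_max_exists x v.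
Qed.

Lemma momentum_uniq x v p : (forall q, F x v q <= F x v p) -> momentum x v = p.
Proof.
move=> pmax; apply/eqP/negPn/negP => ne.
have t01 : 0 < (2^-1 : R) < 1 by rewrite invr_gt0 ltr0n invf_lt1 ?ltr1n.
have := @H_convex x _ _ _ ne t01.
have := pmax (2^-1 *: momentum x v + (1 - 2^-1) *: p).
have := momentumP x v p; have := pmax (momentum x v).
rewrite !dotvE; lra.
Qed.

Lemma lagrangianE x v : lagrangian H x v = F x v (momentum x v).
Proof.
apply/eqP; rewrite eq_le; apply/andP; split.
  apply: ge_sup; first by exists (F x v 0), 0.
  by move=> _ [p _ <-]; exact: momentumP.
apply: sup_upper_bound; last by exists (momentum x v).
split; first by exists (F x v 0), 0.
by exists (F x v (momentum x v)) => _ [p _ <-]; exact: momentumP.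
Qed.

Lemma lagrangian_ge x v p : F x v p <= lagrangian H x v.
Proof. by rewrite lagrangianE momentumP. Qed.

(** On the sphere of radius e about [p0], compactness gives F z p < F z p0 for all z near z0. A
    maximiser outside the sphere would, by concavity along the segment to [p0], produce a point of
    the sphere violating this. *)
Lemma momentum_cont : continuous (fun z : V * V => momentum z.1 z.2).
Proof.
move=> z0; set p0 := momentum z0.1 z0.2.
apply/cvgrPdist_le => e e0.
pose S := [set p : V | `|p - p0| = e].
have cS : compact S := norm_sphere_compact p0 e.
have := (compact_near_coveringP _).1 cS (V * V)%type (nbhs z0)
  (fun z p => F z.1 z.2 p < F z.1 z.2 p0) _.
case.
  move=> p /= pS.
  have pp0 : p != p0 by rewrite -subr_eq0 -normr_eq0 pS gt_eqF.
  have lt0 : 0 < F z0.1 z0.2 p0 - F z0.1 z0.2 p.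
    rewrite subr_gt0 lt_neqAle momentumP andbT; apply/negP => /eqP E.
    move/negP: pp0; apply; apply/eqP; symmetry; apply: momentum_uniq => q.
    by rewrite E momentumP.
  have C : (fun w : V * (V * V) => F w.2.1 w.2.2 p0 - F w.2.1 w.2.2 w.1) @ (p, z0) -->
     F z0.1 z0.2 p0 - F z0.1 z0.2 p.
    have c2 : continuous (fun w : V * (V * V) => w.2) := snd_cont.
    have cA : continuous (fun w : V * (V * V) => F w.2.1 w.2.2 p0).
      apply: (@F_continuous _ (fun w => w.2.1) (fun w => w.2.2) (fun=> p0)) => //.
      - exact: comp_cont fst_cont c2.
      - exact: comp_cont snd_cont c2.
      - exact: cst_continuous.
    have cB : continuous (fun w : V * (V * V) => F w.2.1 w.2.2 w.1).
      apply: (@F_continuous _ (fun w => w.2.1) (fun w => w.2.2) fst) => //.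
      - exact: comp_cont fst_cont c2.
      - exact: comp_cont snd_cont c2.
      - exact: fst_cont.
    exact: (cvgB (cA (p, z0)) (cB (p, z0))).
  have N := cvgr_gt _ C _ lt0.
  case: N => -[A B] nAB AB; exists (A, B) => // w wAB.
  by have := AB w wAB; rewrite /= subr_gt0.
move=> A nA AB; exists A => // z /AB {}AB /=.
rewrite distrC; set q := momentum z.1 z.2.
have [//|qe] := leP `|q - p0| e.
have q0 : 0 < `|q - p0| by apply: lt_trans qe.
pose t := e / `|q - p0|.
have t0 : 0 < t by rewrite divr_gt0.
have t1 : t <= 1 by rewrite ler_pdivrMr// mul1r ltW.
have t01 : 0 <= t <= 1 by rewrite ltW.
have mS : S (t *: q + (1 - t) *: p0).
  rewrite /S/=.
  have -> : t *: q + (1 - t) *: p0 - p0 = t *: (q - p0).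
    by apply/rowP => i; rewrite !mxE; ring.
  by rewrite normrZ gtr0_norm// /t divfK// gt_eqF.
have h1 := AB _ mS.
have h2 := @convexW z.1 q p0 t t01.
have h3 := momentumP z.1 z.2 p0; rewrite -/q in h3.
have h4 : t * F z.1 z.2 p0 <= t * F z.1 z.2 q by rewrite ler_pM2l.
by move: h1 h2 h4; rewrite !dotvE; lra.
Qed.


Lemma lagrangian_cont : continuous (fun z : V * V => lagrangian H z.1 z.2).
Proof.
under eq_fun do rewrite lagrangianE.
by apply: F_continuous; [exact: fst_cont|exact: snd_cont|exact: momentum_cont].
Qed.

Lemma H_shift (x : V) (k : 'I_n -> int) : H (x + int_vec k) = H x.
Proof. by apply/funext => p; exact: H_periodic. Qed.

Lemma lagrangian_periodic v : Zn_periodic (fun x => lagrangian H x v).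
Proof. by move=> x k; rewrite /lagrangian H_shift. Qed.

Lemma gradH_periodic p : Zn_periodic (fun x => grad (H x) p).
Proof. by move=> x k; rewrite H_shift. Qed.

(** Envelope argument: each of the two maximisers is a competitor at the other velocity, so the
    first-order error is at most |h| times the change of the maximiser, which is small by
    [momentum_cont]. *)
Lemma grad_lagrangian x v : grad (lagrangian H x) v = - momentum x v.
Proof.
apply/rowP => i; rewrite !mxE.
set e : V := delta_mx ord0 i.
suff S : slope_at (lagrangian H x) v e (- momentum x v ord0 i).
  by have [_ ->] := slope_derivable S.
move=> eps e0.
have C : continuous (fun h : R => momentum x (v + h *: e) ord0 i).
  have c1 : continuous (fun h : R => (x, v + h *: e)).
    apply: pair_cont; first exact: cst_continuous.
    move=> h; apply: cvgD; first exact: cvg_cst.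
    exact: (cvgZ (@cvg_id _ (nbhs h)) (cvg_cst e)).
  exact: (comp_cont (@coord_continuous _ _ _ ord0 i) (comp_cont momentum_cont c1)).
have /cvgrPdist_le/(_ _ e0) [d /= d0 K] := C 0.
exists d => // h hd.
have := K h; rewrite /= sub0r normrN scale0r addr0 => /(_ hd) {}K.
have up := lagrangian_ge x (v + h *: e) (momentum x v).
have lo := lagrangian_ge x v (momentum x (v + h *: e)).
move: up lo; rewrite !lagrangianE.
rewrite !dotvE /e !dotv_delta -/e => up lo.
set a := momentum x v ord0 i in up lo K *.
set b := momentum x (v + h *: e) ord0 i in up lo K *.
apply: (@le_trans _ _ (`|h| * `|a - b|)); last by rewrite mulrC ler_wpM2r.
rewrite -normrM ler_norml.
have := ler_norm (h * (a - b)); have := ler_norm (- (h * (a - b))).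
by rewrite normrN => ? ?; apply/andP; split; lra.
Qed.

Lemma PhiE z : Phi H z = (z.1, momentum z.1 z.2).
Proof. by rewrite /Phi grad_lagrangian opprK. Qed.

Lemma grad_momentum x v : grad (H x) (momentum x v) = - v.
Proof.
apply/rowP => i; apply: (slope_unique_lower (H_slope x (momentum x v) i)) => h.
have := momentumP x v (momentum x v + h *: delta_mx ord0 i).
by rewrite !dotvE (dotvC (delta_mx _ _)) dotv_delta !mxE; lra.
Qed.

(* By the midpoint inequality, upper slopes at a point of a convex function are
   subadditive in the direction, so the partial derivatives control all of them. *)
Lemma convex_partial_slope x q (v w : V) : v = - grad (H x) q ->
  forall eps : R, 0 < eps -> exists2 d : R, 0 < d & forall t : R, 0 < t < d ->
    F x v q - F x v (q + t *: w) <= eps * t.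
Proof.
move=> vE.
pose Q w := forall eps : R, 0 < eps -> exists2 d : R, 0 < d & forall t : R, 0 < t < d ->
    F x v q - F x v (q + t *: w) <= eps * t.
rewrite (row_sum_delta w); rewrite -/(Q _).
elim/big_ind: _ => [|w1 w2 Q1 Q2|i _].
- move=> eps e0; exists 1 => // t /andP[t0 _].
  by rewrite scaler0 addr0 subrr mulr_ge0// ltW.
- move=> eps e0; have e20 : 0 < eps / 2 by rewrite divr_gt0.
  have [d1 d10 K1] := Q1 _ e20; have [d2 d20 K2] := Q2 _ e20.
  exists (Num.min (d1 / 2) (d2 / 2)); first by rewrite lt_min !divr_gt0.
  move=> t /andP[t0]; rewrite lt_min => /andP[td1 td2].
  have := K1 (2 * t); have := K2 (2 * t).
  rewrite mulr_gt0//= !(mulrC 2 t) -!ltr_pdivlMr// td1 td2 => /(_ isT) k2 /(_ isT) k1.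
  have t01 : 0 <= (2^-1 : R) <= 1 by rewrite invr_ge0 ler0n invf_le1 ?ler1n.
  have := @convexW x (q + (t * 2) *: w1) (q + (t * 2) *: w2) _ t01.
  have -> : 2^-1 *: (q + (t * 2) *: w1) + (1 - 2^-1) *: (q + (t * 2) *: w2) =
    q + t *: (w1 + w2) by apply/rowP => i; rewrite !mxE; field.
  move: k1 k2; rewrite !dotvE; lra.
- set c := w ord0 i => eps e0.
  have c0 : 0 < `|c| + 1 by rewrite ltr_wpDl.
  have [d d0 K] := H_slope x q i (divr_gt0 e0 c0).
  exists (d / (`|c| + 1)); first by rewrite divr_gt0.
  move=> t /andP[t0]; rewrite ltr_pdivlMr// => td.
  have tcd : `|t * c| < d.
    by rewrite normrM (gtr0_norm t0) (le_lt_trans _ td)// ler_pM2l// lerDl.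
  have := K (t * c) tcd.
  rewrite scalerA !dotvE (dotvC (delta_mx _ _)) dotv_delta.
  rewrite (_ : v ord0 i = - grad (H x) q ord0 i); last by rewrite vE mxE.
  rewrite ler_norml => /andP[_ up].
  have : eps / (`|c| + 1) * `|t * c| <= eps * t.
    rewrite mulrAC ler_pdivrMr// -mulrA ler_pM2l// normrM (gtr0_norm t0).
    by rewrite ler_pM2l// lerDl.
  lra.
Qed.

(** A stationary point of a concave function is a global maximum. [convex_partial_slope] only bounds
    increments of F from below, so it is applied in the direction q - r and reflected through q by
    the midpoint inequality. *)
Lemma momentum_grad x q : momentum x (- grad (H x) q) = q.
Proof.
set v := - grad (H x) q; apply: momentum_uniq => r.
apply/ler_addgt0Pl => eps e0.
have [d d0 K] := @convex_partial_slope x q v (- (r - q)) erefl eps e0.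
pose t := Num.min (d / 2) 1.
have t0 : 0 < t by rewrite lt_min divr_gt0//=.
have t1 : t <= 1 by rewrite ge_min lexx orbT.
have td : 0 < t < d by rewrite t0/= gt_min ltr_pdivrMr// ltr_pMr// ltr1n.
have k := K _ td.
have t01 : 0 <= t <= 1 by rewrite ltW.
have h1 := @convexW x r q t t01.
have h01 : 0 <= (2^-1 : R) <= 1 by rewrite invr_ge0 ler0n invf_le1 ?ler1n.
have h2 := @convexW x (t *: r + (1 - t) *: q) (q + t *: - (r - q)) _ h01.
have E : 2^-1 *: (t *: r + (1 - t) *: q) + (1 - 2^-1) *: (q + t *: - (r - q)) = q.
  by apply/rowP => i; rewrite !mxE; field.
rewrite E in h2.
rewrite -(ler_pM2l t0).
move: k h1 h2; rewrite !dotvE.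
set A := H x (t *: r + _); set B := H x (q + _).
set a := dotv r v; set b := dotv q v => k h1 h2; lra.
Qed.

(** Superlinearity is assumed at each x separately; uniformity comes from L, which periodicity
    bounds on the unit ball of velocities. Testing L at the unit vectors and their negatives bounds
    each coordinate of q. *)
Lemma H_coercive (c : R) :
  exists2 K : R, 0 <= K & forall x q, H x q <= c -> `|q| <= K.
Proof.
have [M M0 MP] := periodic_bounded lagrangian_cont lagrangian_periodic 1.
exists (`|c| + M); first by rewrite addr_ge0.
move=> x q Hc; apply: norm_le_coord => [|i]; first by rewrite addr_ge0.
set e : V := delta_mx ord0 i.
have e1 : `|e| <= 1 by exact: norm_delta_le.
have Ne1 : `|- e| <= 1 by rewrite normrN.
have := MP x e e1; have := MP x (- e) Ne1.
have := lagrangian_ge x e q; have := lagrangian_ge x (- e) q.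
rewrite !dotvE dotv_delta /= !ler_norml => ? ? /andP[? ?] /andP[? ?].
by have := ler_norm c => ?; apply/andP; split; lra.
Qed.

End legendre.

(** * Quadratic sup-convolutions *)

Section smoothness.
Context {R : realType} {n : nat}.
Local Notation V := 'rV[R]_n.

Lemma cvg_of_linear_bound (f : V -> R) (x : V) (C : R) :
  (forall w, `|w| <= 1 -> `|f (x + w) - f x| <= C * `|w|) -> f @ x --> f x.
Proof.
move=> fC; apply: (iffRL (@cvgrPdist_le _ _ _ (nbhs x) _ f (f x))) => eps e0.
have D0 : 0 < `|C| + 1 by rewrite ltr_wpDl.
have m0 : 0 < Num.min 1 (eps / (`|C| + 1)) by rewrite lt_min ltr01 divr_gt0.
apply/nbhs_ballP; exists (Num.min 1 (eps / (`|C| + 1))) => //= y.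
rewrite -ball_normE/= lt_min => /andP[xy1 xyd].
rewrite distrC; rewrite distrC in xy1; rewrite distrC in xyd.
have := fC (y - x) (ltW xy1); rewrite subrKC => /le_trans; apply.
move: xyd; rewrite ltr_pdivlMr// => /ltW; apply: le_trans.
by rewrite mulrC ler_wpM2l// (le_trans (ler_norm C))// lerDl.
Qed.

(** Paraboloids of one fixed curvature on both sides of the graph at every point force a Lipschitz
    gradient: the expansions at x and at x + w are compared at a common third point. *)
Lemma C1_of_quadratic_bound (f : V -> R) (q : V -> V) (C : R) : 0 <= C ->
  (forall x w, `|f (x + w) - f x - dotv (q x) w| <= C * dotv w w) ->
  C1 f /\ forall x, grad f x = q x.
Proof.
move=> C0 fq.
have S x (i : 'I_n) : slope_at f x (delta_mx ord0 i) (q x ord0 i).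
  move=> eps e0.
  have D0 : 0 < C + 1 by rewrite ltr_wpDl.
  exists (eps / (C + 1)); first by rewrite divr_gt0.
  move=> h; rewrite ltr_pdivlMr// => hd.
  have := fq x (h *: delta_mx ord0 i).
  rewrite !dotvE !dotv_delta mxE !eqxx mulr1 => /le_trans; apply.
  rewrite -expr2 -(real_normK (num_real h)) expr2 mulrA ler_wpM2r//.
  by rewrite mulrC (le_trans _ (ltW hd))// ler_wpM2l// lerDl.
have D i : 'D_(delta_mx ord0 i) f = fun x => q x ord0 i.
  by apply/funext => x; exact: (slope_derivable (S x i)).2.
have G x : grad f x = q x by apply/rowP => i; rewrite mxE; exact: (slope_derivable (S x i)).2.
split; last by [].
split.
  move=> x; apply: (@cvg_of_linear_bound _ _ (n%:R * `|q x| + C * n%:R)) => w w1.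
  have h1 := fq x w; have h2 := dotv_le_norm (q x) w; have h3 := dotv_sqr_le w.
  have h4 : C * dotv w w <= C * n%:R * `|w|.
    rewrite -mulrA ler_wpM2l// (le_trans h3)// expr2 ler_wpM2l//.
    by rewrite -[leRHS]mulr1 ler_wpM2l.
  have := ler_normD (f (x + w) - f x - dotv (q x) w) (dotv (q x) w).
  rewrite subrK; lra.
move=> i; split=> [x|]; first exact: (slope_derivable (S x i)).1.
rewrite D => x; apply: (@cvg_of_linear_bound (fun x => q x ord0 i) x (3 * C * (1 + n%:R))) => w _.
have [->|w0] := eqVneq w 0.
  by rewrite addr0 subrr !normr0 mulr0.
have wp : 0 < `|w| by rewrite normr_gt0.
have key (s : R) : s ^+ 2 = 1 -> `|w| * (s * (q x ord0 i - q (x + w) ord0 i)) <=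
    `|w| * (3 * C * (1 + n%:R) * `|w|).
  move=> s1.
  (* The third point is x + w + z, at distance |w| from x + w along the i-th axis, so all three
     quadratic errors are of order |w|^2; s = 1 and s = -1 give both signs. *)
  have [z zE] : exists z : V, z = (s * `|w|) *: delta_mx ord0 i by eexists.
  have zz : dotv z z = `|w| ^+ 2.
    rewrite zE !dotvE dotv_delta mxE !eqxx mulr1.
    by rewrite -[RHS]mul1r -s1; ring.
  have b1 := fq (x + w) z; have b2 := fq x (w + z); have b3 := fq x w.
  have p1 : dotv (w + z) (w + z) <= 2 * dotv w w + 2 * dotv z z.
    by have := dotv_sqr_ge0 (w - z); rewrite !dotvE (dotvC z w); lra.
  have p2 := ler_wpM2l C0 p1.
  have p3 := ler_wpM2l C0 (dotv_sqr_le w).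
  have c0 : 0 <= C * dotv z z by rewrite mulr_ge0// dotv_sqr_ge0.
  have -> : `|w| * (s * (q x ord0 i - q (x + w) ord0 i)) = dotv (q x) z - dotv (q (x + w)) z.
    by rewrite zE !dotvE !dotv_delta; ring.
  rewrite zz in b1; move: b1 b2 b3; rewrite addrA (dotvDr w z (q x)) !ler_norml.
  move=> /andP[? ?] /andP[? ?] /andP[? ?].
  rewrite zz in c0 p2 *.
  have -> : `|w| * (3 * C * (1 + n%:R) * `|w|) =
    3 * (C * `|w| ^+ 2) + 3 * (C * (n%:R * `|w| ^+ 2)) by ring.
  lra.
have k1 := key 1 (expr1n _ _); have k2 := key (-1) (sqrr_sign _ 1).
move: k1 k2; rewrite !ler_pM2l// => k1 k2.
by rewrite ler_norml; apply/andP; split; lra.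
Qed.

Lemma C1_quadratic (k : R) (x : V) :
  C1 (fun y => k * dotv (y - x) (y - x)) /\
  forall y, grad (fun y => k * dotv (y - x) (y - x)) y = (2 * k) *: (y - x).
Proof.
apply: (@C1_of_quadratic_bound _ _ `|k|) => // y w.
rewrite -[dotv w w in leRHS]ger0_norm ?dotv_sqr_ge0// -normrM.
rewrite le_eqVlt; apply/orP; left; apply/eqP; congr `|_|.
rewrite !dotvE (dotvC x y) (dotvC w y) (dotvC x w); ring.
Qed.

End smoothness.

Section supconv.
Context {R : realType} {n : nat}.
Local Notation V := 'rV[R]_n.

(** A maximising point chosen once and for all; [supconvP] shows that it exists for bounded
    continuous u. Inf-convolutions are treated as minus the sup-convolution of -u. *)
Definition supconv_arg (a : R) (u : V -> R) (x : V) : V :=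
  xget 0 [set y | forall z, u z - a * dotv (x - z) (x - z) <= u y - a * dotv (x - y) (x - y)].

Definition supconv (a : R) (u : V -> R) (x : V) : R :=
  u (supconv_arg a u x) - a * dotv (x - supconv_arg a u x) (x - supconv_arg a u x).

Variables (a : R) (u : V -> R).
Hypothesis a0 : 0 < a.
Hypothesis cu : continuous u.
Variable B : R.
Hypothesis bu : forall x, `|u x| <= B.

Let B0 : 0 <= B. Proof. exact: le_trans (bu 0). Qed.

Lemma quad_continuous (x : V) : continuous (fun z : V => dotv (x - z) (x - z)).
Proof.
have c : continuous (fun z : V => x - z).
  by move=> z; exact: (cvgB (cvg_cst x) (@cvg_id _ (nbhs z))).
exact: dotv_continuous.
Qed.

Lemma supconvP x z : u z - a * dotv (x - z) (x - z) <= supconv a u x.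
Proof.
rewrite /supconv /supconv_arg; case: xgetP => [y _ /(_ z)//|/= N]; exfalso.
(* Since s >= 1, a point at distance at least s pays a penalty of at least a s = 2B + a, more than
   the oscillation of u. *)
pose s := 2 * B / a + 1.
have s1 : 1 <= s by rewrite lerDr divr_ge0 ?mulr_ge0// ltW.
have r0 : 0 <= `|x| + s by rewrite addr_ge0// (le_trans ler01 s1).
have [|c cr cmax] := @cont_max_ball _ _ (fun z => u z - a * dotv (x - z) (x - z)) _ r0.
  apply: sub_cont => //; apply: mul_cont; first exact: cst_continuous.
  exact: quad_continuous.
apply: (N c) => y.
have [yr|yr] := leP `|y| (`|x| + s); first exact: cmax.
apply: (@le_trans _ _ (u x - a * dotv (x - x) (x - x))); last first.
  by apply: cmax; rewrite lerDl (le_trans ler01 s1).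
have sxy : s <= `|x - y|.
  have := ler_normB x (x - y); rewrite subKr => h; rewrite -(lerD2l `|x|).
  exact: le_trans (ltW yr) h.
have s2 : s <= dotv (x - y) (x - y).
  apply: le_trans (norm_sqr_le_dotv _); rewrite expr2.
  by rewrite (le_trans sxy)// ler_peMl// (le_trans s1).
have E : a * s = 2 * B + a by rewrite /s mulrDr mulr1 mulrC divfK// gt_eqF.
have := ler_wpM2l (ltW a0) s2; rewrite E.
rewrite subrr dotv0l mulr0.
have := bu x; have := bu y; rewrite !ler_norml => /andP[? ?] /andP[? ?]; move: (a0); lra.
Qed.

Lemma supconv_uniq x m :
  (forall z, u z - a * dotv (x - z) (x - z) <= m) ->
  (exists z, m = u z - a * dotv (x - z) (x - z)) -> supconv a u x = m.
Proof.
move=> mub [z mz]; apply/eqP; rewrite eq_le mub /=.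
by rewrite mz supconvP.
Qed.

(** The maximising point y for x remains a competitor for x + w; expanding the square gives a
    paraboloid of slope 2a (y - x) touching from below. *)
Lemma supconv_semiconvex x w :
  supconv a u x + dotv ((2 * a) *: (supconv_arg a u x - x)) w - a * dotv w w
    <= supconv a u (x + w).
Proof.
apply: le_trans (supconvP (x + w) (supconv_arg a u x)).
rewrite /supconv; set y := supconv_arg a u x.
by rewrite !dotvE (dotvC w x) (dotvC y x) (dotvC w y); lra.
Qed.

Lemma supconv_ge x : u x <= supconv a u x.
Proof. by have := supconvP x x; rewrite subrr dotv0l mulr0 subr0. Qed.

Lemma supconv_le x : supconv a u x <= u (supconv_arg a u x).
Proof. by rewrite /supconv gerBl mulr_ge0 ?dotv_sqr_ge0// ltW. Qed.

Lemma supconv_bounded x : `|supconv a u x| <= B.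
Proof.
have := supconv_ge x; have := supconv_le x.
have := bu x; have := bu (supconv_arg a u x).
rewrite !ler_norml => /andP[? ?] /andP[? ?] ? ?.
by apply/andP; split; lra.
Qed.

Lemma supconv_arg_dist x :
  a * dotv (supconv_arg a u x - x) (supconv_arg a u x - x) <= u (supconv_arg a u x) - u x.
Proof.
have := supconv_ge x; rewrite /supconv.
set y := supconv_arg a u x.
by rewrite -(opprB y x) dotvNl dotvNr opprK; lra.
Qed.

Lemma supconv_cont : continuous (supconv a u).
Proof.
pose s := 2 * B / a + 1.
have s1 : 1 <= s by rewrite lerDr divr_ge0 ?mulr_ge0// ltW.
have ds x : `|supconv_arg a u x - x| <= s.
  set d := `|_|; have [d1|d1] := leP d 1; first exact: le_trans s1.
  have h : a * d ^+ 2 <= 2 * B.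
    apply: (le_trans (ler_wpM2l (ltW a0) (norm_sqr_le_dotv _))).
    apply: (le_trans (supconv_arg_dist x)).
    have := bu x; have := bu (supconv_arg a u x); rewrite !ler_norml => /andP[? ?] /andP[? ?]; lra.
  apply: (@le_trans _ _ (2 * B / a)); last by rewrite /s; lra.
  by rewrite ler_pdivlMr// (le_trans _ h)// (mulrC d) ler_wpM2l ?(ltW a0)// expr2 ler_peMl ?(ltW d1) ?normr_ge0.
pose C := n%:R * (2 * a * s) + a * n%:R.
have lo x w : `|w| <= 1 -> supconv a u x - C * `|w| <= supconv a u (x + w).
  move=> w1; apply: le_trans (supconv_semiconvex x w).
  have := dotv_le_norm ((2 * a) *: (supconv_arg a u x - x)) w.
  rewrite ler_norml => /andP[+ _].
  rewrite normrZ gtr0_norm ?mulr_gt0// => h1.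
  have h2 : n%:R * (2 * a * `|supconv_arg a u x - x|) * `|w| <= n%:R * (2 * a * s) * `|w|.
    by rewrite ler_wpM2r// ler_wpM2l// ler_wpM2l// mulr_ge0// ltW.
  have h3 := ler_wpM2l (ltW a0) (dotv_sqr_le w).
  have h4 : a * (n%:R * `|w| ^+ 2) <= a * n%:R * `|w|.
    rewrite -mulrA ler_wpM2l ?(ltW a0)// ler_wpM2l// expr2.
    by rewrite -[leRHS]mulr1 ler_wpM2l.
  rewrite /C; lra.
move=> x; apply: (@cvg_of_linear_bound _ _ _ _ C) => w w1.
have h1 := lo x w w1; have := lo (x + w) (- w); rewrite normrN addrK => /(_ w1) h2.
by rewrite ler_norml; apply/andP; split; lra.
Qed.

Lemma supconv_periodic : Zn_periodic u -> Zn_periodic (supconv a u).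
Proof.
move=> pu x k; apply: supconv_uniq => [z|].
  rewrite -(subrK (int_vec k) z) pu.
  rewrite (_ : x + int_vec k - _ = x - (z - int_vec k)); first exact: supconvP.
  by apply/rowP => i; rewrite !mxE; ring.
exists (supconv_arg a u x + int_vec k); rewrite pu /supconv.
rewrite (_ : x + int_vec k - _ = x - supconv_arg a u x)//.
by apply/rowP => i; rewrite !mxE; ring.
Qed.

End supconv.

(** * Viscosity solutions and C^1 subsolutions *)

Lemma small_scale {R : realFieldType} (A e : R) : 0 <= A -> 0 < e ->
  exists2 t : R, 0 < t & t * A <= e.
Proof.
move=> A0 e0; have D : 0 < A + 1 by rewrite ltr_wpDl.
exists (e / (A + 1)); first by rewrite divr_gt0.
by rewrite mulrAC ler_pdivrMr// ler_wpM2l ?(ltW e0)// lerDl.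
Qed.

Lemma large_scale {R : realFieldType} (A e : R) : 0 <= A -> 0 < e ->
  exists2 a : R, 0 < a & A / a <= e.
Proof.
move=> A0 e0; have D0 : 0 < (A + 1) / e by rewrite divr_gt0// ltr_wpDl.
exists ((A + 1) / e) => //.
rewrite ler_pdivrMr// mulrCA divff ?gt_eqF// mulr1; lra.
Qed.

Section viscosity.
Context {R : realType} {n : nat}.
Local Notation V := 'rV[R]_n.
Variable H : V -> V -> R.
Hypothesis H_smooth : smooth (fun z : V * V => H z.1 z.2).
Hypothesis H_periodic : forall p : V, Zn_periodic (fun x => H x p).
Hypothesis H_convex : forall x : V, strictly_convex (H x).
Hypothesis H_superlinear : forall x : V, superlinear (H x).
Variables (P : V) (c : R) (u : V -> R).
Hypothesis u_periodic : Zn_periodic u.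
Hypothesis u_visc : viscosity_solution (fun x p => H x (P + p)) c u.

Let u_cont : continuous u. Proof. exact: u_visc.1. Qed.

Let Nu_cont : continuous (fun x => - u x). Proof. exact: opp_cont. Qed.

Lemma visc_bounded : exists B : R, forall x : V, `|u x| <= B.
Proof.
have [|p|B _ HB] := @periodic_bounded _ _ (fun z : V * V => u z.1) _ _ 0.
- exact: comp_cont u_cont fst_cont.
- exact: u_periodic.
by exists B => x; apply: (HB x 0); rewrite normr0.
Qed.

Lemma visc_bounded_opp : exists B : R, forall x : V, `|- u x| <= B.
Proof. by have [B HB] := visc_bounded; exists B => x; rewrite normrN. Qed.

(** At the maximising point y, u is touched from above by a paraboloid centred at x, whose gradient
    at y is 2a (y - x). *)
Lemma subsol_at_supconv (a : R) (x : V) : 0 < a ->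
  H (supconv_arg a u x) (P + (2 * a) *: (supconv_arg a u x - x)) <= c.
Proof.
move=> a0; have [B HB] := visc_bounded.
have [C G] := C1_quadratic a x.
rewrite -G; apply: u_visc.2.1 => //.
apply: (@nearW _ (nbhs (supconv_arg a u x))) => y.
have := supconvP a0 u_cont HB x y.
by rewrite /supconv -(opprB y) -(opprB _ x) !dotvNl !dotvNr !opprK.
Qed.

Lemma supsol_at_infconv (a : R) (x : V) : 0 < a ->
  c <= H (supconv_arg a (fun z => - u z) x) (P + (2 * a) *: (x - supconv_arg a (fun z => - u z) x)).
Proof.
move=> a0; have [B HB] := visc_bounded_opp.
have [C G] := C1_quadratic (- a) x.
set y := supconv_arg _ _ _.
have -> : (2 * a) *: (x - y) = (2 * - a) *: (y - x).
  by apply/rowP => i; rewrite !mxE; ring.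
rewrite -G; apply: u_visc.2.2 => //.
apply: (@nearW _ (nbhs y)) => z.
have := supconvP a0 Nu_cont HB x z.
rewrite /supconv -/y -(opprB z) -(opprB y x) !dotvNl !dotvNr !opprK; lra.
Qed.

Lemma subsol_momentum_bound : exists2 K : R, 0 <= K &
  forall x p, H x (P + p) <= c -> `|p| <= K.
Proof.
have [K K0 HK] := H_coercive H_smooth H_periodic H_convex H_superlinear c.
exists (K + `|P|); first by rewrite addr_ge0.
move=> x p /HK h; have := ler_normB (P + p) P.
by rewrite addrAC subrr add0r; move=> /le_trans; apply; rewrite lerD2r.
Qed.

(** The point is a Lipschitz constant independent of a. A displacement z costs a quadratic error a
    n|z|^2; cutting w into M equal steps divides the total error by M. *)
Lemma supconv_lipschitz : exists2 K : R, 0 <= K & forall (a : R) (x w : V), 0 < a ->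
  supconv a u x - K * `|w| <= supconv a u (x + w).
Proof.
have [B HB] := visc_bounded.
have [K K0 HK] := subsol_momentum_bound.
exists (n%:R * K); first by rewrite mulr_ge0.
move=> a x w a0.
have step y z : supconv a u y - n%:R * K * `|z| - a * n%:R * `|z| ^+ 2 <= supconv a u (y + z).
  apply: le_trans (supconv_semiconvex a0 u_cont HB y z).
  have := dotv_le_norm ((2 * a) *: (supconv_arg a u y - y)) z.
  rewrite ler_norml => /andP[+ _].
  have pK := HK _ _ (subsol_at_supconv y a0).
  have h2 : n%:R * `|(2 * a) *: (supconv_arg a u y - y)| * `|z| <= n%:R * K * `|z|.
    by rewrite ler_wpM2r// ler_wpM2l.
  have h3 := ler_wpM2l (ltW a0) (dotv_sqr_le z).
  move: h2 h3; rewrite !mulrA; lra.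
have iter m z : supconv a u x - m%:R * (n%:R * K * `|z| + a * n%:R * `|z| ^+ 2)
    <= supconv a u (x + z *+ m).
  elim: m => [|m IH]; first by rewrite mul0r subr0 mulr0n addr0.
  have := step (x + z *+ m) z; rewrite -(addrA x) -mulrSr -(natr1 m).
  move: IH; move: (_ * `|z|) (_ * `|z| ^+ 2) (supconv _ _ _) (supconv _ _ _) (supconv _ _ _).
  by move=> *; lra.
apply/ler_addgt0Pl => eps e0.
have A0 : 0 <= a * n%:R * `|w| ^+ 2 by rewrite !mulr_ge0// ltW.
have [t t0 tA] := small_scale A0 e0.
have [m] := ltr_add_invr t0; rewrite add0r => mt.
have := iter m.+1 (m.+1%:R^-1 *: w).
have m0 : m.+1%:R != 0 :> R by rewrite pnatr_eq0.
rewrite -[_ *: w *+ _]scaler_nat scalerA mulfV// scale1r normrZ ger0_norm ?invr_ge0//.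
set M : R := m.+1%:R in mt m0 *.
have -> : M * (n%:R * K * (M^-1 * `|w|) + a * n%:R * (M^-1 * `|w|) ^+ 2) =
  n%:R * K * `|w| + M^-1 * (a * n%:R * `|w| ^+ 2) by field.
have : M^-1 * (a * n%:R * `|w| ^+ 2) <= eps.
  by rewrite (le_trans _ tA)// ler_wpM2r// ltW.
move: (M^-1 * _) => Z; lra.
Qed.

Lemma visc_lipschitz : exists2 K : R, 0 <= K & forall x w, u x - K * `|w| <= u (x + w).
Proof.
have [B HB] := visc_bounded.
have [K K0 HK] := subsol_momentum_bound.
have [C C0 HC] := supconv_lipschitz.
exists C => // x w; apply/ler_addgt0Pl => eps e0.
have /cvgrPdist_le/(_ _ e0)/nbhs_ballP[d /= d0 Hd] := u_cont (x := x + w).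
(* This makes 2 a d = 2K + 2 exceed K, so the momentum bound puts the maximising point within d of x
   + w, also when K = 0. *)
pose a := K / d + d^-1.
have a0 : 0 < a by rewrite ltr_wpDl ?invr_gt0 ?divr_ge0// ltW.
have h1 := HC a x w a0; have h2 := supconv_ge a0 u_cont HB x.
have h3 := supconv_le u a0 (x + w).
set y := supconv_arg a u (x + w) in h3.
have py := HK _ _ (subsol_at_supconv (x + w) a0); rewrite -/y in py.
have yd : `|x + w - y| < d.
  have a20 : 0 < 2 * a by rewrite mulr_gt0.
  rewrite distrC -(ltr_pM2l a20) -{1}(gtr0_norm a20) -normrZ (le_lt_trans py)//.
  have -> : 2 * a * d = 2 * K + 2 by rewrite /a; field; rewrite gt_eqF.
  lra.
have := Hd y; rewrite -ball_normE/= => /(_ yd); rewrite ler_norml => /andP[? ?]; lra.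
Qed.


(* Lasry-Lions regularisation: the inf-convolution of a semiconvex function is
   squeezed between two paraboloids at each point, hence C^1. *)
Lemma C1_subsolution (eps : R) : 0 < eps ->
  exists psi : V -> R, [/\ Zn_periodic psi, C1 psi &
    forall x, H x (P + grad psi x) <= c + eps].
Proof.
move=> e0; have [B HB] := visc_bounded.
have [K K0 HK] := subsol_momentum_bound.
have e20 : 0 < eps / 2 by rewrite divr_gt0.
have [d d0 Hd] := periodic_unif (H_cont H_smooth) H_periodic (`|P| + K) e20.
have d20 : 0 < d / 2 by rewrite divr_gt0.
have [a a0 aK] := large_scale K0 d20.
pose f := supconv a u.
have f_cont : continuous f by exact: supconv_cont HB.
have f_bd x : `|- f x| <= B by rewrite normrN; exact: supconv_bounded.
have f_per : Zn_periodic f by exact: supconv_periodic HB _.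
pose g x := - f x.
have g_cont : continuous g by exact: opp_cont.
have b0 : 0 < 2 * a by rewrite mulr_gt0.
pose psi x := - supconv (2 * a) g x.
pose Y x := supconv_arg (2 * a) g x.
pose q x : V := (2 * (2 * a)) *: (x - Y x).
pose p x : V := (2 * a) *: (supconv_arg a u x - x).
have f_semi x w : f x + dotv (p x) w - a * dotv w w <= f (x + w).
  exact: supconv_semiconvex HB _ _.
have p_sub x : H (supconv_arg a u x) (P + p x) <= c by exact: subsol_at_supconv.
have pK x : `|p x| <= K by exact: HK (p_sub x).
have argK x : `|supconv_arg a u x - x| <= K / a / 2.
  rewrite -mulrA -invfM ler_pdivlMr ?mulr_gt0// mulrC (mulrC a).
  by rewrite -(gtr0_norm b0) -normrZ pK.
have psiE x : psi x = f (Y x) + 2 * a * dotv (x - Y x) (x - Y x).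
  by rewrite /psi /supconv /g opprB opprK addrC.
have psi_le x z : psi x <= f z + 2 * a * dotv (x - z) (x - z).
  by have := supconvP b0 g_cont f_bd x z; rewrite /psi /g; lra.
have touch x w : f (Y x) + dotv (q x) w - 2 * a * dotv w w <= f (Y x + w).
  have := psi_le x (Y x + w); rewrite psiE /q.
  move: (Y x) => y.
  by rewrite !dotvE (dotvC y x) (dotvC w x) (dotvC w y); lra.
(* f + a|.|^2 is convex, so a local subgradient is global. Semiconvexity at [Y x + t *: w] bounds f
   there by the chord, [touch] bounds it below up to O(t^2); dividing by t and letting t shrink
   improves the curvature 2a to a. *)
have f_sub x w : f (Y x) + dotv (q x) w - a * dotv w w <= f (Y x + w).
  apply/ler_addgt0Pl => e' e'0.
  have [t0 t00 t0A] := small_scale (mulr_ge0 (ltW a0) (dotv_sqr_ge0 w)) e'0.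
  pose t := Num.min t0 1.
  have tp : 0 < t by rewrite lt_min t00 ltr01.
  have t1 : t <= 1 by rewrite ge_min lexx orbT.
  have tA : t * (a * dotv w w) <= e'.
    by rewrite (le_trans _ t0A)// ler_wpM2r ?mulr_ge0 ?dotv_sqr_ge0 ?(ltW a0)// ge_min lexx.
  have h1 := touch x (t *: w).
  have h2 := f_semi (Y x + t *: w) (- (t *: w)).
  have h3 := f_semi (Y x + t *: w) ((1 - t) *: w).
  rewrite addrK in h2.
  rewrite -(addrA (Y x)) -scalerDl (addrC t) subrK scale1r in h3.
  move: (p _) h2 h3 => m h2 h3.
  have t1' : 0 <= 1 - t by rewrite subr_ge0.
  have h2' := ler_wpM2l t1' h2.
  have h3' := ler_wpM2l (ltW tp) h3.
  move: (t) (f (Y x + t *: w)) (f (Y x)) (f (Y x + w)) tp tA h1 h2' h3' => s F1 F0 Fw sp sA.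
  rewrite !dotvE => h1 h2' h3'.
  rewrite -(ler_pM2l sp).
  have := ler_wpM2l (ltW sp) sA.
  move: h1 h2' h3'; lra.
have psi_quad x w : `|psi (x + w) - psi x - dotv (q x) w| <= 2 * a * dotv w w.
  rewrite ler_norml; apply/andP; split; last first.
    have := psi_le (x + w) (Y x); rewrite (psiE x) /q.
    move: (Y x) => y.
    by rewrite !dotvE (dotvC y x) (dotvC w x) (dotvC w y); lra.
  rewrite (psiE (x + w)) (psiE x).
  have := f_sub x (Y (x + w) - Y x); rewrite subrKC /q.
  move: (Y x) (Y (x + w)) => y z h.
  (* Completing the square leaves a|z - y - 2w|^2 - 2a|w|^2; this is where the inf-convolution needs
     a larger curvature, 2a, than the a of f. *)
  have := mulr_ge0 (ltW a0) (dotv_sqr_ge0 (z - y - 2 *: w)).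
  move: h; rewrite !dotvE (dotvC y x) (dotvC z x) (dotvC z y) (dotvC w x) (dotvC w y) (dotvC w z); lra.
have [C1psi gradpsi] := C1_of_quadratic_bound (ltW b0) psi_quad.
exists psi; split => //.
  apply: (_ : Zn_periodic psi) => x k; rewrite /psi.
  congr (- _); apply: (supconv_periodic b0 g_cont f_bd).
  by move=> y j; rewrite /g f_per.
(* Monotonicity of subgradients, up to curvature, between [Y x] and [Y x + t *: w]; as t shrinks it
   transfers the bounds on p to q. *)
have cmp x w t : 0 < t ->
    dotv (q x) w - 2 * a * (t * dotv w w) <= dotv (p (Y x + t *: w)) w.
  move=> t0; have h1 := f_sub x (t *: w).
  have h2 := f_semi (Y x + t *: w) (- (t *: w)); rewrite addrK in h2.
  rewrite -(ler_pM2l t0); move: h1 h2; move: (p _) => m.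
  rewrite !dotvE; lra.
have qK x : `|q x| <= K.
  apply: norm_le_coord => // i; apply/ler_addgt0Pl => e' e'0.
  have [t t0 tA] := small_scale (ltW b0) e'0.
  have key w : dotv w w = 1 -> `|w| <= 1 -> dotv (q x) w <= e' + `|dotv (p (Y x + t *: w)) w|.
    move=> ww w1; have := cmp x w t t0; rewrite ww.
    have := ler_norm (dotv (p (Y x + t *: w)) w); lra.
  set e : V := delta_mx ord0 i.
  have ee : dotv e e = 1 by rewrite dotv_delta mxE !eqxx.
  have e1 : `|e| <= 1 by exact: norm_delta_le.
  have k1 := key e ee e1.
  have := key (- e); rewrite normrN !dotvNl !dotvNr opprK => /(_ ee e1) k2.
  rewrite normrN in k2.
  rewrite !dotv_delta in k1 k2.
  have := coord_le_norm (p (Y x + t *: e)) i.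
  have := coord_le_norm (p (Y x + t *: - e)) i.
  have := pK (Y x + t *: e); have := pK (Y x + t *: - e).
  by move=> *; rewrite ler_norml; apply/andP; split; lra.
move=> x; rewrite gradpsi.
(* [p_sub] concerns the selected slopes p, while [q x] is only a subgradient at [Y x]. With v
   conjugate to P + q x, Fenchel's inequality for P + p m at m = Y x - t v, together with [cmp],
   gives H(x, P + q x) <= H(x, P + p m) + 2a t|v|^2; and x is close to the point where [p_sub]
   applies to p m. *)
set v := - grad (H x) (P + q x).
have vq := momentum_grad H_smooth H_convex H_superlinear x (P + q x).
have LE := lagrangianE H_smooth H_superlinear x v.
rewrite vq in LE.
have [t1 t10 t1A] := small_scale (mulr_ge0 (ltW b0) (dotv_sqr_ge0 v)) e20.
have d40 : 0 < d / 2 / 2 by rewrite !divr_gt0.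
have [t2 t20 t2A] := small_scale (normr_ge0 v) d40.
pose t := Num.min t1 t2.
have t0 : 0 < t by rewrite lt_min t10.
have tA : t * (2 * a * dotv v v) <= eps / 2.
  by rewrite (le_trans _ t1A)// ler_wpM2r ?mulr_ge0 ?dotv_sqr_ge0 ?(ltW a0)// ge_min lexx.
have tB : t * `|v| <= d / 2 / 2.
  by rewrite (le_trans _ t2A)// ler_wpM2r// ge_min lexx orbT.
set m := Y x + t *: (- v).
have dist : `|x - supconv_arg a u m| <= d.
  have -> : x - supconv_arg a u m = (x - Y x) + (t *: v - (supconv_arg a u m - m)).
    by apply/rowP => i; rewrite /m !mxE; ring.
  have h1 := ler_normD (x - Y x) (t *: v - (supconv_arg a u m - m)).
  have h2 := ler_normB (t *: v) (supconv_arg a u m - m).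
  have h3 := argK m.
  have h4 : `|x - Y x| <= K / a / 2 / 2.
    have -> : K / a / 2 / 2 = K / (2 * (2 * a)) by field; rewrite gt_eqF.
    have b20 : 0 < 2 * (2 * a) by rewrite mulr_gt0.
    by rewrite ler_pdivlMr// mulrC -{1}(gtr0_norm b20) -normrZ qK.
  have h5 : `|t *: v| = t * `|v| by rewrite normrZ gtr0_norm.
  move: (K / a) aK h3 h4 => Ka aK h3 h4; lra.
have Pp : `|P + p m| <= `|P| + K by rewrite (le_trans (ler_normD _ _))// lerD2l.
have h1 := Hd x (supconv_arg a u m) (P + p m) dist Pp.
have h2 := lagrangian_ge H_smooth H_superlinear x v (P + p m).
have h3 := p_sub m.
have h4 := cmp x (- v) t t0.
rewrite -/m (dotvNl v) !(dotvNr _ v) opprK in h4.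
move: h1 h2; rewrite LE !(dotvDl P) /= ler_norml => /andP[_ h1] h2.
move: (dotv v v) (dotv (q x) v) (dotv (p m) v) (dotv P v) h2 h4 tA => vv qv pv Pv.
by move: (t) => s; lra.
Qed.

End viscosity.

(** * Measurability and integration *)

Section measurability.
Context {R : realType} {n : nat}.
Local Notation V := 'rV[R]_n.

Lemma measurable_coord (i : 'I_n) : measurable_fun [set: V] (fun x : V => x ord0 i).
Proof.
move=> _ Y mY; rewrite setTI; apply: sub_sigma_algebra => /=.
rewrite -bigcup_seq/=; exists i => /=; first by rewrite mem_index_enum.
by exists Y => //; rewrite setTI.
Qed.

Lemma measurable_fun_rV d (T : measurableType d) (f : T -> V) :
  (forall i, measurable_fun [set: T] (fun t => f t ord0 i)) ->
  measurable_fun [set: T] f.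
Proof.
move=> mf _ A mA; rewrite setTI.
have : g_sigma_preimage (fun i (x : V) => x ord0 i) `<=` [set B | measurable (f @^-1` B)].
  apply: smallest_sub.
    split => /=; first by rewrite preimage_set0.
      by move=> B mB; rewrite setTD preimage_setC; exact: measurableC.
    by move=> F mF; rewrite preimage_bigcup; exact: bigcupT_measurable.
  rewrite -bigcup_seq => B /= [i _ [Y mY <-]].
  by have := mf i measurableT _ mY; rewrite !setTI.
exact.
Qed.

Lemma measurable_rV_ball (x : V) (e : R) : measurable [set y : V | forall i, `|x ord0 i - y ord0 i| < e].
Proof.
have -> : [set y : V | forall i, `|x ord0 i - y ord0 i| < e] =
  \bigcap_(i in [set: 'I_n]) [set y : V | `|x ord0 i - y ord0 i| < e].
  by apply/seteqP; split => y /= h i; [move=> _; exact: h|exact: h].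
apply: fin_bigcap_measurable => // i _.
have := @measurable_coord i measurableT _ (open_measurable (ball_open (x ord0 i) e)).
by rewrite setTI.
Qed.

(** The sigma-algebra is a product of coordinate-generated ones, so open sets are reached through
    countably many boxes: rational centres, radius 1/(k+1), kept only when contained in A. *)
Lemma open_measurable_rV2 (A : set (V * V)) : open A -> measurable A.
Proof.
move=> oA.
pose Bx (q : 'rV[rat]_n) (k : nat) := [set y : V | forall i, `|(map_mx ratr q : V) ord0 i - y ord0 i| < k.+1%:R^-1].
pose F (z : 'rV[rat]_n * 'rV[rat]_n * nat) := [set w : V * V | (Bx z.1.1 z.2 `*` Bx z.1.2 z.2) w /\ (Bx z.1.1 z.2 `*` Bx z.1.2 z.2) `<=` A].
have -> : A = \bigcup_(z in [set: 'rV[rat]_n * 'rV[rat]_n * nat]) F z.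
  apply/seteqP; split => [[x y] Axy|w [z _ [wz /(_ w wz)]]//].
  have : nbhs (x, y) A by exact: open_nbhs_nbhs.
  move=> /nbhs_ballP[e /= e0 eA].
  have e20 : 0 < e / 2 by rewrite divr_gt0.
  have [k] := ltr_add_invr e20; rewrite add0r => ke.
  have kp : 0 < k.+1%:R^-1 :> R by rewrite invr_gt0.
  have approx (v : V) : exists q : 'rV[rat]_n, Bx q k v.
    have ex i : exists q : rat, `|ratr q - v ord0 i| < k.+1%:R^-1.
      have [r [vr [q _ qr]]] := @dense_rat R (ball (v ord0 i) k.+1%:R^-1)
        (ex_intro _ (v ord0 i) (ballxx _ kp)) (ball_open _ _).
      by exists q; rewrite qr distrC.
    have [g gP] := choice ex.
    by exists (\row_i g i) => i; rewrite !mxE.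
  have [qx qxP] := approx x; have [qy qyP] := approx y.
  exists (qx, qy, k) => //; split => //= -[x' y'] [/= x'P y'P].
  apply: eA.
  have close (q : 'rV[rat]_n) (v v' : V) : Bx q k v -> Bx q k v' -> ball v e v'.
    move=> h h'; rewrite -ball_normE/=.
    rewrite (le_lt_trans (_ : _ <= k.+1%:R^-1 + k.+1%:R^-1))//; last by rewrite (splitr e) ltrD.
    apply: norm_le_coord => [|i]; first by rewrite addr_ge0// ltW.
    rewrite !mxE; have := h i; have := h' i.
    have -> : v ord0 i - v' ord0 i = (map_mx ratr q ord0 i - v' ord0 i) - (map_mx ratr q ord0 i - v ord0 i) by ring.
    move=> h1 h2; rewrite (le_trans (ler_normB _ _))// lerD// ltW//.
  by split; [exact: close qxP x'P|exact: close qyP y'P].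
apply: countable_bigcupT_measurable => // z.
have [zA|zA] := pselect (Bx z.1.1 z.2 `*` Bx z.1.2 z.2 `<=` A).
  rewrite (_ : F z = Bx z.1.1 z.2 `*` Bx z.1.2 z.2).
    by apply: measurableX; exact: measurable_rV_ball.
  by apply/seteqP; split => [w []|w ?]//.
rewrite (_ : F z = set0)//.
by apply/seteqP; split => [w []|w]//.
Qed.

Lemma continuous_measurable_rV2 (f : V * V -> R) : continuous f ->
  measurable_fun [set: V * V] f.
Proof.
move=> /continuousP cf; apply: (measurability _ (RGenOpens.measurableE R)).
move=> _ [_ [a [b ->] <-]]; rewrite setTI; apply: open_measurable_rV2.
exact/cf/interval_open.
Qed.

Lemma measurable_frac d (T : measurableType d) (f : T -> V) :
  (forall i, measurable_fun [set: T] (fun t => f t ord0 i)) ->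
  measurable_fun [set: T] (fun t => frac (f t)).
Proof.
move=> mf; apply: measurable_fun_rV => i.
under eq_fun do rewrite frac_coord.
apply: measurable_funB; first exact: mf.
apply: (@measurableT_comp _ _ _ _ _ _ (fun x : R => (Num.floor x)%:~R : R)) => //.
apply: nondecreasing_measurable => // x y xy.
by rewrite ler_int; exact: le_floor.
Qed.

End measurability.

(** * Integrals whose absolute convergence has to be established *)

Section integration.
Context d (T : measurableType d) (R : realType).
Local Open Scope ereal_scope.

(** Positive and negative parts are transported separately, so the identity covers infinite values
    and applies to (a), (b), (c) before their absolute convergence is known. *)
Lemma integral_pushforward_measurable d' (Y : measurableType d') (mu : {measure set T -> \bar R})
    (phi : T -> Y) (f : Y -> \bar R) :
  measurable_fun [set: T] phi -> measurable_fun [set: Y] f ->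
  \int[pushforward mu phi]_y f y = \int[mu]_x f (phi x).
Proof.
move=> mphi mf; rewrite [LHS]integralE [RHS]integralE.
rewrite (ge0_integral_pushforward mphi mu)//; last exact: measurable_funepos.
rewrite (ge0_integral_pushforward mphi mu)//; last exact: measurable_funeneg.
by congr (_ - _); apply: eq_integral => x _; rewrite /= ?funeposE ?funenegE.
Qed.

Variable mu : {measure set T -> \bar R}.

Lemma integrable_posneg (f : T -> \bar R) : measurable_fun [set: T] f ->
  \int[mu]_x f^\+ x < +oo -> \int[mu]_x f^\- x < +oo -> mu.-integrable [set: T] f.
Proof.
move=> mf fp fn; apply/integrableP; split => //.
under eq_integral => x _ do rewrite -[`|f x|]/((abse \o f) x) fune_abse.
rewrite ge0_integralD//; [exact: lte_add_pinfty|exact: measurable_funepos|exact: measurable_funeneg].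
Qed.

(* The convention [+oo - +oo = -oo] makes a vanishing integral absolutely convergent. *)
Lemma integral0_integrable (f : T -> \bar R) : measurable_fun [set: T] f ->
  \int[mu]_x f x = 0 -> mu.-integrable [set: T] f.
Proof.
move=> mf; rewrite integralE.
have : 0 <= \int[mu]_x f^\+ x by exact: integral_ge0.
have : 0 <= \int[mu]_x f^\- x by exact: integral_ge0.
have := @integrable_posneg f mf.
case: (\int[mu]_x f^\- x) => [r| |]//; case: (\int[mu]_x f^\+ x) => [s| |]//.
by move=> h _ _ _; apply: h; exact: ltry.
Qed.

Lemma integrable_bounded_below (f : T -> R) (M : R) : mu [set: T] = 1 ->
  measurable_fun [set: T] f -> (forall x, (- M <= f x)%R) ->
  \int[mu]_x (f x)%:E < +oo -> mu.-integrable [set: T] (EFin \o f).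
Proof.
move=> mu1 mf fM If.
have mEf : measurable_fun [set: T] (EFin \o f) by exact/measurable_EFinP.
have fn : \int[mu]_x (EFin \o f)^\- x < +oo.
  apply: (@le_lt_trans _ _ (\int[mu]_x (cst `|M|%:E) x)).
    apply: ge0_le_integral => //; first exact: measurable_funeneg.
    move=> x _; rewrite funenegE /= ge_max !lee_fin normr_ge0 andbT.
    by rewrite (le_trans _ (ler_norm M))// lerNl.
  by rewrite integral_cst// mu1 mule1 ltry.
apply: integrable_posneg => //.
move: If; rewrite integralE.
have : 0 <= \int[mu]_x (EFin \o f)^\- x by exact: integral_ge0.
move: fn; rewrite -[(fun x => (f x)%:E)]/(EFin \o f).
case: (\int[mu]_x _^\- x) => [r| |]//; case: (\int[mu]_x _^\+ x) => [s| |]//.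
by move=> *; exact: ltry.
Qed.

Lemma integralN_EFin (f : T -> R) : mu.-integrable [set: T] (EFin \o f) ->
  \int[mu]_x (- f x)%:E = - \int[mu]_x (f x)%:E.
Proof.
move=> If.
transitivity (\int[mu]_x ((-1)%:E * (EFin \o f) x)).
  by apply: eq_integral => x _ /=; rewrite -EFinM mulN1r.
by rewrite integralZl// EFinN mulN1e.
Qed.

Lemma integralD_cst (f : T -> R) (k : R) : mu [set: T] = 1 ->
  mu.-integrable [set: T] (EFin \o f) ->
  mu.-integrable [set: T] (EFin \o (fun x => f x + k)%R) /\
  \int[mu]_x (f x + k)%:E = \int[mu]_x (f x)%:E + k%:E.
Proof.
move=> mu1 If.
have Ik : mu.-integrable [set: T] (EFin \o (cst k : T -> R)).
  apply/integrableP; split; first exact/measurable_EFinP.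
  by rewrite [ltLHS](_ : _ = \int[mu]_x (cst `|k|%:E) x)// integral_cst// mu1 mule1 ltry.
split.
  have := integrableD measurableT If Ik.
  by apply: eq_integrable.
rewrite -[RHS](_ : \int[mu]_x ((EFin \o f) x + (EFin \o (cst k : T -> R)) x) = _)//.
by rewrite integralD//= [in LHS]integral_cst// mu1 mule1.
Qed.

End integration.

(** * Lower bound on the action *)

Section lower_bound.
Context {R : realType} {n : nat}.
Local Notation V := 'rV[R]_n.
Variable H : V -> V -> R.
Hypothesis H_smooth : smooth (fun z : V * V => H z.1 z.2).
Hypothesis H_periodic : forall p : V, Zn_periodic (fun x => H x p).
Hypothesis H_convex : forall x : V, strictly_convex (H x).
Hypothesis H_superlinear : forall x : V, superlinear (H x).
Variables (P : V) (c : R) (u : V -> R).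
Hypothesis u_periodic : Zn_periodic u.
Hypothesis u_visc : viscosity_solution (fun x p => H x (P + p)) c u.

(** This is the Lagrangian of (x, p) -> H(x, P + p), by the shift p -> P + p in the supremum. *)
Definition tilted (z : V * V) : R := lagrangian H z.1 z.2 + dotv P z.2.

Lemma tilted_cont : continuous tilted.
Proof.
apply: add_cont; first exact: lagrangian_cont.
by apply: dotv_continuous; [exact: cst_continuous|exact: snd_cont].
Qed.

Lemma tilted_bounded_below : exists M : R, forall z, - M <= tilted z.
Proof.
have [M _ HM] := periodic_bounded (H_cont H_smooth) H_periodic `|P|.
exists M => -[x v]; rewrite /tilted /=.
have := lagrangian_ge H_smooth H_superlinear x v P.
have := ler_norm (H x P); have := HM x P (lexx _); rewrite /=; lra.
Qed.

Lemma grad_cont (psi : V -> R) : C1 psi -> continuous (grad psi).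
Proof.
move=> [_ C]; apply: rV_continuous => i.
by under eq_fun do rewrite mxE; exact: (C i).2.
Qed.

Lemma dotv_grad_cont (psi : V -> R) : C1 psi ->
  continuous (fun z : V * V => dotv z.2 (grad psi z.1)).
Proof.
move=> C; apply: dotv_continuous; first exact: snd_cont.
exact: comp_cont (grad_cont C) fst_cont.
Qed.

Definition gap (psi : V -> R) (eps : R) (z : V * V) : R :=
  tilted z + dotv z.2 (grad psi z.1) + (c + eps).

Lemma gap_cont (psi : V -> R) (eps : R) : C1 psi -> continuous (gap psi eps).
Proof.
move=> C; apply: add_cont; last exact: cst_continuous.
by apply: add_cont; [exact: tilted_cont|exact: dotv_grad_cont].
Qed.

Lemma gapE (psi : V -> R) (eps : R) (x v : V) :
  gap psi eps (x, v) =
    (lagrangian H x v + dotv (P + grad psi x) v + H x (P + grad psi x))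
    + (c + eps - H x (P + grad psi x)).
Proof. by rewrite /gap /tilted /= dotvDl (dotvC v); ring. Qed.

Lemma gap_ge0 (psi : V -> R) (eps : R) z :
  (forall x, H x (P + grad psi x) <= c + eps) -> 0 <= gap psi eps z.
Proof.
case: z => x v /(_ x) Hpsi; rewrite gapE.
have := lagrangian_ge H_smooth H_superlinear x v (P + grad psi x); lra.
Qed.

Local Open Scope ereal_scope.

Implicit Type nu : probability (V * V)%type R.

Lemma tilted_integrable nu : action H P nu < +oo ->
  nu.-integrable [set: V * V] (EFin \o tilted).
Proof.
move=> fin; have [M HM] := tilted_bounded_below.
apply: (integrable_bounded_below (probability_setT nu) _ HM fin).
by apply: continuous_measurable_rV2; exact: tilted_cont.
Qed.

Lemma gap_integral nu (psi : V -> R) (eps : R) : holonomic nu ->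
  nu.-integrable [set: V * V] (EFin \o tilted) -> Zn_periodic psi -> C1 psi ->
  \int[nu]_z (gap psi eps z)%:E = action H P nu + (c + eps)%:E.
Proof.
move=> [_ hol] It per C.
have mg : measurable_fun [set: V * V] (EFin \o (fun z : V * V => dotv z.2 (grad psi z.1))).
  by apply/measurable_EFinP; apply: continuous_measurable_rV2; exact: dotv_grad_cont.
have Ig := integral0_integrable mg (hol psi per C).
have Itg : nu.-integrable [set: V * V] (EFin \o (fun z => tilted z + dotv z.2 (grad psi z.1))%R).
  exact: (integrableD measurableT It Ig).
have [_ ->] := integralD_cst (c + eps) (probability_setT nu) Itg.
congr (_ + _).
transitivity (\int[nu]_z ((EFin \o tilted) z + (EFin \o (fun z : V * V => dotv z.2 (grad psi z.1))) z)) => //.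
by rewrite integralD// [X in _ + X](hol psi per C) adde0.
Qed.

Lemma action_ge nu : holonomic nu -> (- c)%:E <= action H P nu.
Proof.
move=> hol; have [fin|] := ltP (action H P nu) +oo; last first.
  by rewrite leye_eq => /eqP ->; rewrite leey.
have It := tilted_integrable fin.
have fn : action H P nu \is a fin_num by exact: integrable_fin_num It.
rewrite -(fineK fn) lee_fin; apply/ler_addgt0Pl => eps e0.
have [psi [per C sub]] := C1_subsolution H_smooth H_periodic H_convex H_superlinear u_periodic u_visc e0.
have : 0 <= \int[nu]_z (gap psi eps z)%:E.
  by apply: integral_ge0 => z _; rewrite lee_fin gap_ge0.
rewrite gap_integral// -(fineK fn) -EFinD lee_fin; lra.
Qed.

End lower_bound.

(** * Minimizers live on the critical level set *)

Section equivalence.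
Context {R : realType} {n : nat}.
Local Notation V := 'rV[R]_n.
Variable H : V -> V -> R.
Hypothesis H_smooth : smooth (fun z : V * V => H z.1 z.2).
Hypothesis H_periodic : forall p : V, Zn_periodic (fun x => H x p).
Hypothesis H_convex : forall x : V, strictly_convex (H x).
Hypothesis H_superlinear : forall x : V, superlinear (H x).
Variables (P : V) (c : R) (u : V -> R).
Hypothesis u_periodic : Zn_periodic u.
Hypothesis u_visc : viscosity_solution (fun x p => H x (P + p)) c u.

Lemma Phi_cont : continuous (Phi H).
Proof.
rewrite (_ : Phi H = fun z => (z.1, momentum H z.1 z.2)).
  by apply: pair_cont; [exact: fst_cont|exact: momentum_cont].
by apply/funext => z; exact: PhiE.
Qed.

Lemma measurable_Phi : measurable_fun [set: V * V] (Phi H).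
Proof.
apply/measurable_fun_pairP; split; apply: measurable_fun_rV => i;
  apply: continuous_measurable_rV2.
- apply: (comp_cont (@coord_continuous _ _ _ ord0 i)).
  exact: comp_cont fst_cont Phi_cont.
- apply: (comp_cont (@coord_continuous _ _ _ ord0 i)).
  exact: comp_cont snd_cont Phi_cont.
Qed.

(* A small gap makes [P + grad psi] almost attain the supremum defining the
   Lagrangian, hence close to its unique maximiser. *)
Lemma gap_ge_off_level (z : V * V) : H (Phi H z).1 (Phi H z).2 != c ->
  exists2 d : R, 0 < d & forall (eps : R) (psi : V -> R), 0 < eps -> eps < d ->
    (forall x, H x (P + grad psi x) <= c + eps) -> d <= gap H P c psi eps z.
Proof.
case: z => x v; rewrite PhiE//=; set p0 := momentum H x v => Hc.
have LE := lagrangianE H_smooth H_superlinear x v; rewrite -/p0 in LE.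
pose g q := lagrangian H x v + dotv q v + H x q.
have g0 q : 0 <= g q.
  by have := lagrangian_ge H_smooth H_superlinear x v q; rewrite /g; lra.
have gp0 : g p0 = 0 by rewrite /g LE; ring.
pose e := `|H x p0 - c| / 2.
have e0 : 0 < e by rewrite divr_gt0// normr_gt0 subr_eq0.
have cHx : continuous (H x).
  exact: (comp_cont (H_cont H_smooth) (pair_cont (@cst_continuous _ _ x) (fun p => @cvg_id _ (nbhs p)))).
have /cvgrPdist_lt/(_ _ e0)/nbhs_ballP[r /= r0 Hr] := cHx p0.
pose s := r / 2.
have s0 : 0 < s by rewrite divr_gt0.
have cg : continuous g.
  apply: add_cont cHx; apply: add_cont; first exact: cst_continuous.
  by apply: dotv_continuous; [move=> p; exact: cvg_id|exact: cst_continuous].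
have [m m0 Hm] : exists2 m : R, 0 < m & forall p, `|p - p0| = s -> m <= g p.
  have [[p1 p1S]|S0] := pselect ([set p : V | `|p - p0| = s] !=set0); last first.
    by exists 1 => // p pS; exfalso; apply: S0; exists p.
  have [||p2] := @compact_EVT_min _ _ g [set p : V | `|p - p0| = s] _ (norm_sphere_compact p0 s).
  - by exists p1.
  - exact: continuous_subspaceT.
  rewrite inE/= => p2S p2min.
  exists (g p2); last by move=> p pS; apply: p2min; rewrite inE.
  rewrite lt_neqAle g0 andbT eq_sym; apply/negP => /eqP gp2.
  have p2E : p0 = p2.
    apply: momentum_uniq => // q; have := lagrangian_ge H_smooth H_superlinear x v q.
    by move: gp2; rewrite /g; lra.
  by move: s0; rewrite -p2S -p2E subrr normr0 ltxx.
have far q : s < `|q - p0| -> m <= g q.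
  move=> sq; have q0 : 0 < `|q - p0| by apply: lt_trans sq.
  pose t := s / `|q - p0|.
  have t0 : 0 < t by rewrite divr_gt0.
  have t1 : t <= 1 by rewrite ler_pdivrMr// mul1r ltW.
  have t01 : 0 <= t <= 1 by rewrite ltW.
  have tS : `|t *: q + (1 - t) *: p0 - p0| = s.
    have -> : t *: q + (1 - t) *: p0 - p0 = t *: (q - p0).
      by apply/rowP => i; rewrite !mxE; ring.
    by rewrite normrZ gtr0_norm// /t divfK// gt_eqF.
  apply: (le_trans (Hm _ tS)).
  have h1 := convexW H_convex x q p0 t01.
  have h2 : t * g q <= g q by rewrite ler_piMl.
  have h3 : t * g q = t * lagrangian H x v + t * dotv q v + t * H x q.
    by rewrite /g; ring.
  have h4 : (1 - t) * g p0 = 0 by rewrite gp0 mulr0.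
  move: h1 h2 h3 h4; rewrite /g !dotvE.
  move: (t) => w; lra.
(* A gap below m puts q = P + grad psi x within s of [p0], where H differs from H(x, p0) by less
   than e; a gap below e and eps < e put H(x, q) within e of c. Together |H(x, p0) - c| < 2e,
   against the choice of e. *)
exists (Num.min m e); first by rewrite lt_min m0 e0.
move=> eps psi eps0 epsd sub; rewrite leNgt; apply/negP.
rewrite lt_min => /andP[gm ge].
move: epsd; rewrite lt_min => /andP[_ epse].
have Hq := sub x; set q := P + grad psi x in Hq.
have gE : gap H P c psi eps (x, v) = g q + (c + eps - H x q) by rewrite gapE.
have gq := g0 q.
have qn : `|q - p0| <= s by rewrite leNgt; apply/negP => /far; rewrite gE in gm; lra.
have qr : ball p0 r q.
  rewrite -ball_normE/= distrC (le_lt_trans qn)// /s; lra.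
have := Hr q qr; rewrite /= ltr_norml => /andP[a1 a2].
rewrite gE in ge.
have ne : `|H x p0 - c| = 2 * e by rewrite /e mulrC divfK.
have : `|H x p0 - c| < 2 * e by rewrite ltr_norml; apply/andP; split; lra.
by rewrite ne ltxx.
Qed.

Implicit Type nu : probability (V * V)%type R.

(** [A m] collects the points where all gaps from index m on are at least 1/(m+1). Markov's
    inequality gives nu (A m) <= (m+1)/(k+1) for every k >= m, hence 0, and each off-level point
    lies in some [A m]. *)
Lemma minimizer_on_level nu : holonomic nu -> action H P nu = (- c)%:E ->
  nu.-negligible [set z | H (Phi H z).1 (Phi H z).2 != c].
Proof.
move=> hol act.
have It : nu.-integrable [set: V * V] (EFin \o tilted H P).
  by apply: tilted_integrable => //; rewrite act ltry.
have ek (k : nat) : 0 < (k.+1%:R^-1 : R) by rewrite invr_gt0.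
have ex k := C1_subsolution H_smooth H_periodic H_convex H_superlinear u_periodic u_visc (ek k).
have [psi psiP] := choice ex.
pose G k z := gap H P c (psi k) k.+1%:R^-1 z.
have G0 k z : 0 <= G k z by have [_ _ sub] := psiP k; exact: gap_ge0.
have mG k : measurable_fun [set: V * V] (G k).
  by apply: continuous_measurable_rV2; apply: gap_cont => //; have [] := psiP k.
have IG k : (\int[nu]_z (G k z)%:E = k.+1%:R^-1%:E)%E.
  have [per C _] := psiP k.
  by rewrite gap_integral// act -EFinD addrA addNr add0r.
pose A (m : nat) := \bigcap_(k in [set k | (m <= k)%N]) [set z | m.+1%:R^-1 <= G k z].
have mA m : measurable (A m).
  apply: bigcap_measurableType => k _.
  have := measurable_fun_le measurableT (@measurable_cst _ _ _ _ setT (m.+1%:R^-1 : R)) (mG k).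
  by rewrite setTI.
have A0 m : nu (A m) = 0%E.
  apply/eqP; rewrite eq_le measure_ge0 andbT.
  have bound k : (m <= k)%N -> (m.+1%:R^-1%:E * nu (A m) <= k.+1%:R^-1%:E)%E.
    move=> mk; rewrite -(IG k) -(integral_cst nu (mA m)).
    apply: (@le_trans _ _ (\int[nu]_(z in A m) (G k z)%:E)%E).
      apply: ge0_le_integral => //.
      - by move=> z _; rewrite lee_fin.
      - apply/measurable_EFinP; exact: measurable_funTS.
      - by move=> z Az; rewrite /= lee_fin; exact: Az.
    apply: ge0_subset_integral => //.
    - exact/measurable_EFinP.
    - by move=> z _; rewrite lee_fin.
  have fn : nu (A m) \is a fin_num by exact: fin_num_measure.
  rewrite -(fineK fn) lee_fin.
  have b' k : (m <= k)%N -> m.+1%:R^-1 * fine (nu (A m)) <= k.+1%:R^-1.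
    by move=> /bound; rewrite -(fineK fn) -EFinM lee_fin fineK.
  apply/ler_addgt0Pl => e e0; rewrite addr0.
  have e1 : 0 < m.+1%:R^-1 * e by rewrite mulr_gt0.
  have [k] := ltr_add_invr e1; rewrite add0r => ke.
  rewrite -(ler_pM2l (ek m)) (le_trans (b' (maxn m k) (leq_maxl _ _)))//.
  rewrite (le_trans _ (ltW ke))// lef_pV2 ?posrE// ler_nat ltnS.
  exact: leq_maxr.
apply: (@negligibleS _ _ _ _ (\bigcup_m A m)); last first.
  by apply: negligible_bigcup => m; apply/(negligibleP nu (mA m)); exact: A0.
move=> z /= /gap_ge_off_level[d d0 Hd].
(* One index serves twice: 1/(m+1) < d is the lower bound required by [A m], and it forces eps =
   1/(k+1) < d for k >= m. *)
have [m] := ltr_add_invr d0; rewrite add0r => md.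
exists m => // k /= mk; have [_ _ sub] := psiP k.
apply: (le_trans (ltW md)); apply: Hd => //.
apply: le_lt_trans md; rewrite lef_pV2 ?posrE// ler_nat ltnS //.
Qed.

End equivalence.

(** * Holonomic measures carried by polygonal loops *)

Section line_integral.
Context {R : realType} {n : nat}.
Local Notation V := 'rV[R]_n.

Lemma slope_line (f : V -> R) (y e : V) (s l : R) : slope_at f (y + s *: e) e l ->
  is_derive s 1 (fun r : R => f (y + r *: e)) l.
Proof.
move=> S; have [] : derivable (fun r : R => f (y + r *: e)) s 1 /\ 'D_1 (fun r : R => f (y + r *: e)) s = l.
  apply: slope_derivable => eps /S[d d0 K]; exists d => // h /K.
  rewrite -(addrA y) -scalerDl /=.
  by rewrite [h *: 1]mulr1.
by move=> D1 D2; exact: DeriveDef.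
Qed.

(** Coordinates of w are added one at a time, which displaces the base point; hence [Q] is uniform
    over base points y near x, as continuity of the partial derivatives allows. *)
Lemma C1_slope (f : V -> R) (x w : V) : C1 f -> slope_at f x w (dotv (grad f x) w).
Proof.
move=> [cf Df].
pose Q w := forall eps : R, 0 < eps -> exists2 d : R, 0 < d &
  forall y t, `|y - x| < d -> `|t| < d ->
    `|f (y + t *: w) - f y - t * dotv (grad f x) w| <= eps * `|t|.
suff QP : Q w.
  move=> eps /QP[d d0 K]; exists d => // h hd; apply: K => //.
  by rewrite subrr normr0.
rewrite (row_sum_delta w).
elim/big_ind: _ => [|w1 w2 Q1 Q2|i _].
- move=> eps e0; exists 1 => // y t _ _.
  by rewrite scaler0 addr0 subrr dotv0r mulr0 subr0 normr0 mulr_ge0// ltW.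
- move=> eps e0; have e20 : 0 < eps / 2 by rewrite divr_gt0.
  have [d1 d10 K1] := Q1 _ e20; have [d2 d20 K2] := Q2 _ e20.
  pose d := Num.min d1 (d2 / 2 / (1 + `|w1|)).
  have D0 : 0 < 1 + `|w1| by rewrite ltr_pwDl.
  exists d; first by rewrite lt_min d10/= !divr_gt0.
  move=> y t; rewrite /d !lt_min => /andP[y1 y2] /andP[t1 t2].
  have h1 := K1 y t y1 t1.
  have le2 : d2 / 2 / (1 + `|w1|) <= d2 / 2.
    by rewrite ler_pdivrMr// ler_peMr ?lerDl// ltW// divr_gt0.
  have y3 : `|y + t *: w1 - x| < d2.
    rewrite addrAC (le_lt_trans (ler_normD _ _))// normrZ (splitr d2) ltrD//.
      exact: lt_le_trans y2 le2.
    move: t2; rewrite ltr_pdivlMr//; apply: le_lt_trans.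
    by rewrite ler_wpM2l// lerDr.
  have t3 : `|t| < d2.
    by rewrite (lt_le_trans t2)// (le_trans le2)// ler_pdivrMr// ler_peMr ?(ltW d20)// ler1n.
  have h2 := K2 _ t y3 t3.
  rewrite scalerDr addrA dotvDr.
  move: h1 h2; rewrite !ler_norml => /andP[? ?] /andP[? ?].
  by apply/andP; split; lra.
- set e : V := delta_mx ord0 i; set k := w ord0 i => eps e0.
  have K0 : 0 < `|k| + 1 by rewrite ltr_wpDl.
  have e1 : 0 < eps / (`|k| + 1) by rewrite divr_gt0.
  have [Dfi cDfi] := Df i.
  have /cvgrPdist_le/(_ _ e1)/nbhs_ballP[d /= d0 Hd] := cDfi x.
  exists (d / 2 / (`|k| + 1)); first by rewrite !divr_gt0.
  have le2 : d / 2 / (`|k| + 1) <= d / 2.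
    by rewrite ler_pdivrMr// ler_peMr ?lerDr// ltW// divr_gt0.
  move=> y t yx; rewrite ltr_pdivlMr// => td.
  rewrite scalerA dotvZr dotv_delta mxE mulrA.
  pose g (r : R) := f (y + r *: e) - r * 'D_e f x.
  pose dg (r : R) := 'D_e f (y + r *: e) - 'D_e f x.
  have gD (r : R) : is_derive r 1 g (dg r).
    apply: is_deriveB; first by apply: slope_line; apply: derivable_slope.
    have [] : derivable (fun s : R => s * 'D_e f x) r 1 /\ 'D_1 (fun s : R => s * 'D_e f x) r = 'D_e f x.
      apply: slope_derivable => e' e'0; exists 1 => // h _.
      rewrite [h *: 1]mulr1 (_ : _ - _ - _ = 0); last by ring.
      by rewrite normr0 mulr_ge0// ltW.
    by move=> D1 D2; exact: DeriveDef.
  have near (r : R) : `|r| <= `|t * k| -> `|dg r| <= eps / (`|k| + 1).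
    move=> rt; rewrite distrC; apply: Hd; rewrite -ball_normE/=.
    rewrite opprD addrA (le_lt_trans (ler_normB _ _))// (splitr d) ltrD//.
      by rewrite distrC (lt_le_trans yx).
    rewrite normrZ (le_lt_trans (ler_wpM2l _ (norm_delta_le i)))// mulr1.
    rewrite (le_lt_trans rt)// normrM (le_lt_trans _ td)// ler_wpM2l// lerDl//.
  have mvt (r1 r2 : R) : r1 <= r2 -> (forall r, r1 <= r <= r2 -> `|r| <= `|t * k|) ->
      `|g r2 - g r1| <= eps / (`|k| + 1) * (r2 - r1).
    move=> r12 rb.
    have cg : continuous g.
      move=> r; apply: differentiable_continuous.
      by apply/derivable1_diffP; have [] := gD r.
    have [r rI ->] := @MVT_segment R g dg r1 r2 r12 (fun r _ => gD r) (@continuous_subspaceT _ _ `[r1, r2] g cg).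
    rewrite normrM (ger0_norm (_ : 0 <= r2 - r1)) ?subr_ge0// ler_wpM2r ?subr_ge0//.
    by apply: near; apply: rb; rewrite in_itv in rI.
  have fin : `|g (t * k) - g 0| <= eps / (`|k| + 1) * `|t * k|.
    have [tk|tk] := leP 0 (t * k).
      have := @mvt 0 (t * k) tk; rewrite subr0; rewrite {2}(ger0_norm tk); apply.
      by move=> r /andP[r0 rt]; rewrite !ger0_norm.
    have := @mvt (t * k) 0 (ltW tk); rewrite sub0r distrC {2}(ltr0_norm tk); apply.
    by move=> r /andP[r0 rt]; rewrite ler0_norm// ltr0_norm// lerN2.
  move: fin; rewrite /g scale0r addr0 mul0r subr0.
  rewrite (_ : _ - _ - _ = f (y + (t * k) *: e) - f y - t * k * 'D_e f x); last by ring.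
  move=> /le_trans; apply.
  rewrite mulrAC ler_pdivrMr// -mulrA ler_pM2l// normrM ler_wpM2l// lerDl//.
Qed.

Lemma line_integral (f : V -> R) (a w : V) : C1 f ->
  (\int[@lebesgue_measure R]_(s in `[0%R, 1%R]) (dotv (grad f (a + s *: w)) w)%:E =
    (f (a + w) - f a)%:E)%E.
Proof.
move=> Cf.
pose F (s : R) := f (a + s *: w).
have DF (s : R) : is_derive s 1 F (dotv (grad f (a + s *: w)) w).
  by apply: slope_line; exact: C1_slope.
have cF : continuous F.
  move=> s; apply: differentiable_continuous.
  by apply/derivable1_diffP; have [] := DF s.
have cl : continuous (fun s : R => a + s *: w).
  by move=> s; apply: cvgD; [exact: cvg_cst|exact: (cvgZ (@cvg_id _ (nbhs s)) (cvg_cst w))].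
have cgrad : continuous (grad f).
  by apply: rV_continuous => i; under eq_fun do rewrite mxE; exact: (Cf.2 i).2.
rewrite (@continuous_FTC2 _ _ F)//.
- by rewrite /F scale1r scale0r addr0 EFinB.
- apply: continuous_subspaceT.
  by apply: dotv_continuous; [exact: comp_cont cgrad cl|exact: cst_continuous].
- split.
  + by move=> s _; have [] := DF s.
  + by apply: cvg_at_right_filter; exact: cF.
  + by apply: cvg_at_left_filter; exact: cF.
- by move=> s _; rewrite derive1E; have [_ ->] := DF s.
Qed.

End line_integral.

Section average.
Context d (T : measurableType d) (R : realType).
Variables (p : nat -> probability T R) (N : nat).
Local Open Scope ereal_scope.

Let inv_ge0 : (0 <= N.+1%:R^-1 :> R)%R. Proof. by rewrite invr_ge0. Qed.

Definition average : set T -> \bar R := mscale (NngNum inv_ge0) (msum p N.+1).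

HB.instance Definition _ := Measure.on average.

Let average_setT : average [set: T] = 1.
Proof.
rewrite /average /mscale/= /msum (eq_bigr (fun=> 1)); last first.
  by move=> i _; exact: probability_setT.
by rewrite sumEFin sumr_const card_ord -EFinM mulVf// pnatr_eq0.
Qed.

HB.instance Definition _ := Measure_isProbability.Build _ _ R average average_setT.

Lemma integral_average (f : T -> \bar R) : measurable_fun [set: T] f ->
  (forall k, (p k).-integrable [set: T] f) ->
  \int[average]_x f x = N.+1%:R^-1%:E * \sum_(k < N.+1) \int[p k]_x f x.
Proof.
move=> mf If.
have ge0 (g : T -> \bar R) : measurable_fun [set: T] g -> (forall x, 0 <= g x) ->
    \int[average]_x g x = N.+1%:R^-1%:E * \sum_(k < N.+1) \int[p k]_x g x.
  move=> mg g0; rewrite ge0_integral_mscale//=; congr (_ * _).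
  by rewrite ge0_integral_measure_sum.
rewrite integralE !ge0//; [|exact: measurable_funeneg|exact: measurable_funepos].
have fn k : \int[p k]_x f^\- x \is a fin_num by apply: integrable_neg_fin_num => //; exact: If.
rewrite -muleBr//; last first.
  by apply: fin_num_adde_defl; rewrite fin_numN; apply/sum_fin_numP => i _ _; exact: fn.
congr (_ * _); rewrite -fin_num_sumeN; last by move=> i _; exact: fn.
by rewrite -big_split; apply: eq_bigr => i _; rewrite [RHS]integralE.
Qed.

End average.

Lemma bounded_integrable d (T : measurableType d) (R : realType) (p : probability T R)
    (g : T -> R) (M : R) : measurable_fun [set: T] g -> (forall x, `|g x| <= M) ->
  p.-integrable [set: T] (EFin \o g).
Proof.
move=> mg gM; apply/integrableP; split; first exact/measurable_EFinP.
apply: (@le_lt_trans _ _ (\int[p]_x (cst M%:E) x)%E); last first.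
  by rewrite integral_cst// [X in (_ * X)%E](probability_setT p) mule1 ltry.
apply: ge0_le_integral => //.
- by apply: measurableT_comp => //; exact/measurable_EFinP.
- by move=> x _; rewrite /= lee_fin.
Qed.

Section loop.
Context {R : realType} {n : nat}.
Local Notation V := 'rV[R]_n.

Definition unif01 : probability (measurableTypeR R) R := uniform_prob (@ltr01 R).

Lemma integral_unif01 (g : R -> R) : continuous g ->
  (\int[unif01]_s (g s)%:E = \int[@lebesgue_measure R]_(s in `[0%R, 1%R]) (g s)%:E)%E.
Proof.
move=> cg; have mg : measurable_fun [set: R] (EFin \o g).
  by apply/measurable_EFinP; exact: continuous_measurable_fun.
rewrite [LHS]integralE [RHS]integralE.
rewrite (@integral_uniform _ _ _ (@ltr01 R))//; last exact: measurable_funepos.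
rewrite (@integral_uniform _ _ _ (@ltr01 R))//; last exact: measurable_funeneg.
by rewrite subr0 invr1 !mul1e.
Qed.

Lemma segment_cont (a w : V) : continuous (fun s : R => a + s *: w).
Proof. by move=> s; apply: cvgD; [exact: cvg_cst|exact: (cvgZ (@cvg_id _ (nbhs s)) (cvg_cst w))]. Qed.

Section segments.
Variables (a v : nat -> V) (h : R).

(** One Euler step of duration h with its time rescaled to [0, 1]: the displacement is h v, the
    recorded velocity v. [frac] keeps the position in the unit cube, as torus measures require. *)
Definition segment_map (k : nat) (s : measurableTypeR R) : V * V :=
  (frac (a k + s *: (h *: v k)), v k).

Lemma measurable_segment_map k : measurable_fun [set: measurableTypeR R] (segment_map k).
Proof.
apply/measurable_fun_pairP; split; last exact: measurable_cst.
apply: measurable_frac => i; apply: continuous_measurable_fun.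
exact: (comp_cont (@coord_continuous _ _ _ ord0 i) (@segment_cont _ _)).
Qed.

HB.instance Definition _ k :=
  isMeasurableFun.Build _ _ _ _ (segment_map k) (measurable_segment_map k).

Definition loop_measure (N : nat) : probability (V * V)%type R :=
  average (fun k => distribution unif01 (segment_map k)) N.

Lemma loop_measure_torus N : torus_prob (loop_measure N).
Proof.
rewrite /torus_prob /loop_measure /= /average /mscale/= /msum (eq_bigr (fun=> 1%E)).
  by rewrite sumEFin sumr_const card_ord -EFinM mulVf// pnatr_eq0.
move=> k _; rewrite /distribution /pushforward /= (_ : _ @^-1` _ = [set: _]).
  exact: (probability_setT unif01).
by apply/seteqP; split => // s _; split => //=; exact: frac_cube.
Qed.

Lemma integral_loop_measure (f : V * V -> R) (N : nat) : continuous f ->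
  (forall p, Zn_periodic (fun x => f (x, p))) ->
  (\int[loop_measure N]_z (f z)%:E = N.+1%:R^-1%:E *
    \sum_(k < N.+1) \int[unif01]_s (f (a k + s *: (h *: v k), v k))%:E)%E.
Proof.
move=> cf pf.
have mf : measurable_fun [set: V * V] (EFin \o f).
  by apply/measurable_EFinP; apply: continuous_measurable_rV2.
have cfk k : continuous (fun s : R => f (a k + s *: (h *: v k), v k)).
  exact: (comp_cont cf (pair_cont (@segment_cont _ _) (@cst_continuous _ _ (v k)))).
have E k : f \o segment_map k = (fun s : R => f (a k + s *: (h *: v k), v k)).
  by apply/funext => s; rewrite /= /segment_map (periodic_frac _ (pf (v k))).
have Ik k : (distribution unif01 (segment_map k)).-integrable [set: V * V] (EFin \o f).
  apply: (integrable_pushforward (measurable_segment_map k) mf _ measurableT).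
  rewrite preimage_setT.
  have [M _ HM] := periodic_bounded cf pf `|v k|.
  apply: (@bounded_integrable _ _ _ unif01 (f \o segment_map k) M).
    by rewrite E; exact: continuous_measurable_fun.
  by move=> s; exact: HM.
rewrite integral_average//; congr (_ * _)%E; apply: eq_bigr => k _.
rewrite (integral_pushforward_measurable unif01 (measurable_segment_map k) mf).
by apply: eq_integral => s _ /=; rewrite -[X in X%:E]/((f \o segment_map k) s) E.
Qed.

Lemma loop_measure_holonomic (N : nat) (m : 'I_n -> int) : h != 0 ->
  (forall k, (k <= N)%N -> a k.+1 = a k + h *: v k) -> a N.+1 = a 0%N + int_vec m ->
  holonomic (loop_measure N).
Proof.
move=> h0 ha aN; split; first exact: loop_measure_torus.
move=> psi per C.
have pgrad : Zn_periodic (grad psi).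
  move=> x k; apply/rowP => i; rewrite !mxE.
  have S := derivable_slope ((C.2 i).1 x).
  suff /slope_derivable[] : slope_at psi (x + int_vec k) (delta_mx ord0 i) ('D_(delta_mx ord0 i) psi x) by [].
  move=> eps /S[d d0 K]; exists d => // t /K.
  by rewrite (addrAC x) !per.
rewrite (integral_loop_measure N (dotv_grad_cont C)); last by move=> p x k; rewrite /= pgrad.
(* Each segment contributes an increment of psi, with 1/h converting the displacement h v back to
   the velocity v; the sum telescopes and periodicity closes it up. *)
rewrite (eq_bigr (fun k : 'I_N.+1 => (h^-1 * (psi (a k.+1) - psi (a k)))%:E)).
  rewrite sumEFin -mulr_sumr -(big_mkord xpredT (fun k => psi (a k.+1) - psi (a k))).
  by rewrite telescope_sumr// aN per subrr mulr0 mule0.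
move=> k _ /=.
have cw : continuous (fun s : R => dotv (grad psi (a k + s *: (h *: v k))) (h *: v k)).
  apply: dotv_continuous; last exact: cst_continuous.
  exact: (comp_cont (grad_cont C) (@segment_cont _ _)).
rewrite integral_unif01.
  transitivity (h^-1%:E * \int[@lebesgue_measure R]_(s in `[0%R, 1%R])
     (dotv (grad psi (a k + s *: (h *: v k))) (h *: v k))%:E)%E.
    rewrite -integralZl//.
      apply: eq_integral => s _.
      by rewrite -EFinM dotvZr mulKf// dotvC.
    by apply: continuous_compact_integrable; [exact: segment_compact|exact: continuous_subspaceT].
  by rewrite line_integral// -EFinM ha// -ltnS.
apply: dotv_continuous; first exact: cst_continuous.
exact: (comp_cont (grad_cont C) (@segment_cont _ _)).
Qed.

End segments.
End loop.

(** * Upper bound on the minimal action *)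

Section upper_bound.
Context {R : realType} {n : nat}.
Local Notation V := 'rV[R]_n.
Variable H : V -> V -> R.
Hypothesis H_smooth : smooth (fun z : V * V => H z.1 z.2).
Hypothesis H_periodic : forall p : V, Zn_periodic (fun x => H x p).
Hypothesis H_convex : forall x : V, strictly_convex (H x).
Hypothesis H_superlinear : forall x : V, superlinear (H x).
Variables (P : V) (c : R) (u : V -> R).
Hypothesis u_periodic : Zn_periodic u.
Hypothesis u_visc : viscosity_solution (fun x p => H x (P + p)) c u.

Lemma tilted_periodic v : Zn_periodic (fun x => tilted H P (x, v)).
Proof. by move=> x k; rewrite /tilted /= lagrangian_periodic. Qed.

(* [W] is the inf-convolution of [u], and [vel] the characteristic velocity at
   the minimising point: there [u] is touched from below by a paraboloid, so the
   supersolution property bounds the cost of an Euler step. *)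
Lemma discrete_calibration (eps : R) : 0 < eps ->
  exists h B (W : V -> R) (vel : V -> V), [/\ 0 < h, forall x, `|W x| <= B &
    forall x s, 0 <= s <= 1 ->
      h * (tilted H P (x + s *: (h *: vel x), vel x) + c - eps) <= W x - W (x + h *: vel x)].
Proof.
move=> e0; have [B HB] := visc_bounded_opp u_periodic u_visc.
have [K K0 HK] := visc_lipschitz H_smooth H_periodic H_convex H_superlinear u_periodic u_visc.
pose g x := - u x.
have cg : continuous g by exact: opp_cont u_visc.1.
have cnG : continuous (fun z : V * V => `|grad (H z.1) z.2|).
  exact: (comp_cont (@norm_continuous _ _) (gradH_cont H_smooth)).
(* Order of the constants: the slope bound 2K, hence the speed bound r, does not involve a; so d may
   depend on r, a on d, and h on a. *)
have [r r0 Hr] := periodic_bounded cnG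
  (fun p x k => congr1 Num.norm (gradH_periodic H_periodic p x k)) (`|P| + 2 * K).
have e20 : 0 < eps / 2 by rewrite divr_gt0.
have [d d0 Hd] := periodic_unif (@tilted_cont R n H H_smooth H_convex H_superlinear P) tilted_periodic r e20.
have d20 : 0 < d / 2 by rewrite divr_gt0.
have [a a0 aK] := large_scale K0 d20.
have nr0 : 0 <= a * (n%:R * r ^+ 2) by rewrite !mulr_ge0 ?sqr_ge0// ltW.
have [h1 h10 h1A] := small_scale nr0 e20.
have [h2 h20 h2A] := small_scale r0 d20.
pose h := Num.min h1 h2.
have h0 : 0 < h by rewrite lt_min h10.
have hA : h * (a * (n%:R * r ^+ 2)) <= eps / 2.
  by rewrite (le_trans _ h1A)// ler_wpM2r// ge_min lexx.
have hB : h * r <= d / 2.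
  by rewrite (le_trans _ h2A)// ler_wpM2r// ge_min lexx orbT.
pose Y x := supconv_arg a g x.
pose p x : V := (2 * a) *: (x - Y x).
pose vel x : V := - grad (H (Y x)) (P + p x).
exists h, B, (fun x => - supconv a g x), vel; split => //.
  by move=> x; rewrite normrN; exact: (supconv_bounded a0 cg HB).
move=> x s /andP[s0 s1].
(* With y = Y x: a|y - x|^2 <= u x - u y <= K|y - x|, by optimality of y and the Lipschitz bound. *)
have yx : a * `|Y x - x| <= K.
  have h3 := supconv_arg_dist a0 cg HB x; rewrite -/(Y x) in h3.
  have h4 := ler_wpM2l (ltW a0) (norm_sqr_le_dotv (Y x - x)).
  have h5 := HK x (Y x - x); rewrite subrKC in h5.
  have [z0|z0] := eqVneq (Y x - x) 0; first by rewrite z0 normr0 mulr0.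
  have zp : 0 < `|Y x - x| by rewrite normr_gt0.
  rewrite -(ler_pM2r zp); move: h3 h4 h5; rewrite /g expr2; lra.
have yd : `|Y x - x| <= d / 2.
  by apply: le_trans aK; rewrite ler_pdivlMr// mulrC.
have pK : `|p x| <= 2 * K.
  rewrite /p normrZ distrC gtr0_norm ?mulr_gt0//.
  by rewrite -mulrA ler_wpM2l.
have vr : `|vel x| <= r.
  rewrite /vel normrN; apply: (le_trans (ler_norm _)); apply: (Hr (Y x)).
  by rewrite (le_trans (ler_normD _ _))// lerD2l.
have sup := supsol_at_infconv u_periodic u_visc x a0; rewrite -/g -/(Y x) -/(p x) in sup.
have LE := lagrangianE H_smooth H_superlinear (Y x) (vel x).
rewrite (momentum_grad H_smooth H_convex H_superlinear) in LE.
have semi := supconv_semiconvex a0 cg HB x (h *: vel x); rewrite -/(Y x) in semi.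
have tl : `|tilted H P (x + s *: (h *: vel x), vel x) - tilted H P (Y x, vel x)| <= eps / 2.
  apply: Hd => //.
  rewrite addrAC (le_trans (ler_normD _ _))// (splitr d) lerD//; first by rewrite distrC.
  rewrite scalerA normrZ ger0_norm ?mulr_ge0 ?(ltW h0)//.
  rewrite (le_trans _ hB)// -mulrA (le_trans (ler_piMl _ s1))//.
    by rewrite mulr_ge0 // ltW.
  by rewrite ler_wpM2l// ltW.
have vv : a * dotv (vel x) (vel x) <= a * (n%:R * r ^+ 2).
  rewrite ler_wpM2l ?(ltW a0)// (le_trans (dotv_sqr_le _))// ler_wpM2l//.
  by rewrite ler_pXn2r ?nnegrE.
have hvv : h * (a * dotv (vel x) (vel x)) <= eps / 2.
  by rewrite (le_trans _ hA)// ler_wpM2l// ltW.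
have pE : (2 * a) *: (Y x - x) = - p x by rewrite /p -scalerN opprB.
rewrite pE in semi.
move: tl; rewrite ler_norml => /andP[_ tl].
have tY : tilted H P (Y x, vel x) <= - dotv (p x) (vel x) - c.
  by rewrite /tilted /= LE dotvDl; lra.
(* One eps/2 pays for moving the integrand from [Y x] to the segment, the other for the quadratic
   term of the semiconcavity estimate. *)
have step1 : tilted H P (x + s *: (h *: vel x), vel x) + c - eps <=
    - dotv (p x) (vel x) - h * (a * dotv (vel x) (vel x)) by lra.
apply: (le_trans (ler_wpM2l (ltW h0) step1)).
move: semi; rewrite !(dotvNl, dotvZl, dotvZr); clearbody h; lra.
Qed.

Lemma action_le (eps : R) : 0 < eps ->
  exists2 nu : probability (V * V)%type R, holonomic nu &
    (action H P nu <= (- c + eps)%:E)%E.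
Proof.
move=> e0; have e20 : 0 < eps / 2 by rewrite divr_gt0.
have [h [B [W [vel [h0 WB cal]]]]] := discrete_calibration e20.
pose X (k : nat) := iter k (fun x => x + h *: vel x) (0 : V).
have cT := @tilted_cont R n H H_smooth H_convex H_superlinear P.
have [M M0 HM] := periodic_bounded cT tilted_periodic h^-1.
(* [D] bounds what does not grow with N: the telescoped [W], the closing segment, and the mismatch
   between N and N.+1 copies of the mean value. *)
pose D := h^-1 * (2 * B) + M + `|c| + `|eps|.
have D0 : 0 <= D.
  by rewrite !addr_ge0// mulr_ge0 ?invr_ge0 ?(ltW h0)// mulr_ge0// (le_trans _ (WB 0)).
have [t t0 tD] := small_scale D0 e20.
have [N] := ltr_add_invr t0; rewrite add0r => Nt.
(* The loop is closed at the integer corner of the cell of [X N], at max-norm distance at most 1.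
   The closing velocity is thus at most 1/h, the radius for which [M] was chosen. *)
pose m := zfloor (X N).
pose a (k : nat) : V := if (k <= N)%N then X k else int_vec m.
pose v (k : nat) : V := if (k < N)%N then vel (X k) else h^-1 *: (int_vec m - X N).
have av k : (k <= N)%N -> a k.+1 = a k + h *: v k.
  rewrite leq_eqVlt => /predU1P[->|kN]; last by rewrite /a /v kN (ltnW kN).
  by rewrite /a /v ltnn leqnn scalerA divff ?gt_eqF// scale1r subrKC.
exists (loop_measure a v h N).
  apply: (@loop_measure_holonomic _ _ a v h N m) => //; first by rewrite gt_eqF.
  by rewrite /a ltnn add0r.
rewrite /action (integral_loop_measure a v h N cT tilted_periodic).
pose b (k : nat) := if (k < N)%N then - c + eps / 2 + h^-1 * (W (X k) - W (X k.+1)) else M.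
have le_b (k : 'I_N.+1) :
    (\int[unif01]_s (tilted H P (a k + s *: (h *: v k), v k))%:E <= (b k)%:E)%E.
  have cs : continuous (fun s : R => tilted H P (a k + s *: (h *: v k), v k)).
    exact: (comp_cont cT (pair_cont (@segment_cont _ _ _ _) (@cst_continuous _ _ (v k)))).
  have I01 (f : R -> R) : continuous f ->
      (@lebesgue_measure R).-integrable `[0%R, 1%R] (EFin \o f).
    move=> cf; apply: continuous_compact_integrable; first exact: segment_compact.
    exact: continuous_subspaceT.
  rewrite integral_unif01//.
  apply: (@le_trans _ _ (\int[@lebesgue_measure R]_(s in `[0%R, 1%R]) (cst (b k)%:E) s)%E); last first.
    rewrite integral_cst// [X in (_ * X)%E](@lebesgue_measure_itv R `[0, 1])/=.
    by rewrite lte_fin ltr01 -EFinD subr0 mule1.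
  apply: le_integral => //; first exact: I01.
    exact: (I01 (cst (b k)) (@cst_continuous _ _ (b k))).
  move=> s; rewrite inE/= in_itv/= => s01; rewrite lee_fin /b /a /v -ltnS ltn_ord.
  case: ifPn => [kN|kN].
    have /= cs01 := cal (X k) s s01.
    rewrite -lerBlDl -(ler_pM2l h0) mulrA divff ?gt_eqF// mul1r.
    by apply: le_trans cs01; rewrite ler_pM2l//; lra.
  have -> : (k : nat) = N by apply/eqP; rewrite eqn_leq -ltnS ltn_ord leqNgt kN.
  apply: (le_trans (ler_norm _)); apply: HM.
  rewrite normrZ gtr0_norm ?invr_gt0// -[leRHS]mulr1 ler_wpM2l ?invr_ge0 ?(ltW h0)//.
  by rewrite distrC; exact/cube_norm/frac_cube.
apply: (@le_trans _ _ (N.+1%:R^-1%:E * \sum_(k < N.+1) (b k)%:E)%E).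
  by rewrite lee_pmul2l// ?lte_fin ?invr_gt0//; apply: lee_sum => k _; exact: le_b.
rewrite sumEFin -EFinM lee_fin big_ord_recr/= {2}/b ltnn.
rewrite (eq_bigr (fun k : 'I_N => (- c + eps / 2) + h^-1 * (W (X k) - W (X k.+1)))); last first.
  by move=> k _; rewrite /b ltn_ord.
rewrite big_split/= sumr_const card_ord -mulr_sumr.
rewrite -(big_mkord xpredT (fun k => W (X k) - W (X k.+1))).
have -> : \sum_(0 <= k < N) (W (X k) - W (X k.+1)) = W (X 0%N) - W (X N).
  by rewrite -[RHS]opprB -(@telescope_sumr _ 0 N (fun k => W (X k)))// -sumrN; apply: eq_bigr => k _; rewrite opprB.
have N0 : 0 < N.+1%:R :> R by [].
rewrite ler_pdivrMl// -(mulr_natl (- c + _)).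
have dN : D <= N.+1%:R * (eps / 2).
  have := ler_wpM2r D0 (ltW Nt) => /le_trans/(_ tD).
  by rewrite ler_pdivrMl.
have W2 : h^-1 * (W (X 0%N) - W (X N)) <= h^-1 * (2 * B).
  rewrite ler_pM2l ?invr_gt0//.
  have := WB (X 0%N); have := WB (X N).
  rewrite !ler_norml => /andP[? ?] /andP[? ?]; lra.
have c1 := ler_norm c; have e1 := ler_norm eps.
have e2 := normr_ge0 eps.
move: dN W2; rewrite /D -(natr1 N).
move: (h^-1 * (2 * B)) (h^-1 * _) => Z1 Z2; move: (N%:R : R) => NR; lra.
Qed.

End upper_bound.

(** * The equivalence *)

Theorem theorem1p3 (R : realType) (n : nat)
  (H : 'rV[R]_n -> 'rV[R]_n -> R)
  (H_smooth : smooth (fun z : ('rV[R]_n * 'rV[R]_n)%type => H z.1 z.2))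
  (H_periodic : forall p : 'rV[R]_n, Zn_periodic (fun x => H x p))
  (H_convex : forall x : 'rV[R]_n, strictly_convex (H x))
  (H_superlinear : forall x : 'rV[R]_n, superlinear (H x))
  (P : 'rV[R]_n) (Hbar_P : R) (Hbar_def : is_effective_hamiltonian H P Hbar_P)
  (nu : probability ('rV[R]_n * 'rV[R]_n)%type R) (nu_torus : torus_prob nu) :
  is_minimizer H P nu <->
  (let mu := pushforward nu (Phi H) in
   ((\int[mu]_z (H z.1 z.2)%:E = Hbar_P%:E)%E /\
    {ae mu, forall z, H z.1 z.2 = Hbar_P}) /\
   (\int[mu]_z (dotv (z.2 - P) (grad (H z.1) z.2))%:E = 0)%E /\
   (forall phi : 'rV[R]_n -> R, Zn_periodic phi -> C1 phi ->
      (\int[mu]_z (dotv (grad (H z.1) z.2) (grad phi z.1))%:E = 0)%E)).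
Proof.
have [u [u_per u_visc]] := Hbar_def.
have mPhi := measurable_Phi H_smooth H_convex H_superlinear.
have cH := H_cont H_smooth.
have cG := gradH_cont H_smooth.
pose K (z : 'rV[R]_n * 'rV[R]_n) := H (Phi H z).1 (Phi H z).2.
have cPhi := Phi_cont H_smooth H_convex H_superlinear.
have cK : continuous K := comp_cont cH cPhi.
have mK : measurable_fun [set: 'rV[R]_n * 'rV[R]_n] (EFin \o K).
  by apply/measurable_EFinP; apply: continuous_measurable_rV2.
have ct := @tilted_cont R n H H_smooth H_convex H_superlinear P.
have mt : measurable_fun [set: 'rV[R]_n * 'rV[R]_n] (EFin \o tilted H P).
  by apply/measurable_EFinP; apply: continuous_measurable_rV2.
have PhiE' := PhiE H_smooth H_convex H_superlinear.
have gradPhi z : grad (H (Phi H z).1) (Phi H z).2 = - z.2.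
  by rewrite PhiE' /= (grad_momentum H_smooth H_superlinear).
have mpush (f : 'rV[R]_n * 'rV[R]_n -> R) : continuous f ->
    (\int[pushforward nu (Phi H)]_z (f z)%:E = \int[nu]_z (f (Phi H z))%:E)%E.
  move=> cf; apply: (integral_pushforward_measurable nu mPhi).
  by apply/measurable_EFinP; apply: continuous_measurable_rV2.
have IH : (\int[pushforward nu (Phi H)]_z (H z.1 z.2)%:E = \int[nu]_z (K z)%:E)%E.
  exact: (mpush (fun z => H z.1 z.2)).
(* At the momentum p, D_pH = -v, so (p - P).D_pH = -p.v + P.v, which is L + P.v + H(x, p) because p
   attains the supremum. *)
have Ib : (\int[pushforward nu (Phi H)]_z (dotv (z.2 - P) (grad (H z.1) z.2))%:E =
    \int[nu]_z (tilted H P z + K z)%:E)%E.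
  rewrite (mpush (fun z => dotv (z.2 - P) (grad (H z.1) z.2))).
    apply: eq_integral => z _; congr EFin; rewrite gradPhi /K PhiE' /tilted /=.
    by rewrite (lagrangianE H_smooth H_superlinear) dotvDl !dotvNl !dotvNr; ring.
  apply: dotv_continuous; last exact: cG.
  by move=> z; apply: cvgB; [exact: snd_cont|exact: cvg_cst].
have Ic (phi : 'rV[R]_n -> R) : C1 phi ->
    (\int[pushforward nu (Phi H)]_z (dotv (grad (H z.1) z.2) (grad phi z.1))%:E =
    \int[nu]_z (- dotv z.2 (grad phi z.1))%:E)%E.
  move=> C; rewrite (mpush (fun z => dotv (grad (H z.1) z.2) (grad phi z.1))).
    by apply: eq_integral => z _; rewrite gradPhi dotvNl PhiE'.
  apply: dotv_continuous; first exact: cG.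
  exact: comp_cont (grad_cont C) fst_cont.
have mdot (phi : 'rV[R]_n -> R) : C1 phi -> measurable_fun [set: 'rV[R]_n * 'rV[R]_n]
    (EFin \o (fun z : 'rV[R]_n * 'rV[R]_n => dotv z.2 (grad phi z.1))).
  by move=> C; apply/measurable_EFinP; apply: continuous_measurable_rV2; exact: dotv_grad_cont.
have nu1 := probability_setT nu.
have Kcst : {ae nu, forall z, K z = Hbar_P} ->
    (\int[nu]_z (tilted H P z + K z)%:E = \int[nu]_z (tilted H P z + Hbar_P)%:E)%E.
  move=> aeK; apply: ae_eq_integral => //.
  - by apply/measurable_EFinP; apply: continuous_measurable_rV2; exact: add_cont.
  - apply/measurable_EFinP; apply: continuous_measurable_rV2; apply: add_cont => //.
    exact: cst_continuous.
  - by apply: filterS aeK => z /= -> _.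
split.
- move=> [hol nu_min].
  have act : action H P nu = (- Hbar_P)%:E.
    apply/eqP; rewrite eq_le (action_ge H_smooth H_periodic H_convex H_superlinear u_per u_visc hol) andbT.
    apply/lee_addgt0Pr => e e0; rewrite -EFinD.
    have [nu' hol' le'] := action_le H_smooth H_periodic H_convex H_superlinear u_per u_visc e0.
    exact: le_trans (nu_min _ hol') le'.
  have off := minimizer_on_level H_smooth H_periodic H_convex H_superlinear u_per u_visc hol act.
  have aeK : {ae nu, forall z, K z = Hbar_P}.
    by apply: negligibleS off => z /= /eqP.
  have It : nu.-integrable setT (EFin \o tilted H P).
    by apply: tilted_integrable => //; rewrite act ltry.
  (* Negligibility for the push-forward asks for a measurable superset in the (x, p) variables; the
     off-level set itself is measurable, H being continuous. *)
  have mB : measurable [set z : 'rV[R]_n * 'rV[R]_n | H z.1 z.2 != Hbar_P].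
    have mH := continuous_measurable_rV2 cH.
    have := mH measurableT _ (measurableC (measurable_set1 Hbar_P)).
    rewrite setTI; congr measurable; apply/seteqP; split => z /=; by move/eqP.
  split; first split.
  + rewrite IH (ae_eq_integral (cst Hbar_P%:E))//.
      by rewrite integral_cst// [X in (_ * X)%E]nu1 mule1.
    by apply: filterS aeK => z /= -> _.
  + exists [set z | H z.1 z.2 != Hbar_P]; split => //.
      rewrite /pushforward; apply: measure_negligible off.
      by rewrite -[X in measurable X]setTI; exact: (mPhi measurableT _ mB).
    by move=> z /= /eqP.
  split.
  + rewrite Ib (Kcst aeK) (integralD_cst Hbar_P nu1 It).2.
    by rewrite -[X in (X + _)%E]/(action H P nu) act -EFinD addNr.
  + move=> phi per C; rewrite (Ic phi C) integralN_EFin.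
      by rewrite hol.2// oppe0.
    by apply: integral0_integrable; [exact: mdot|exact: hol.2].
- move=> [[_ [B [mB B0 BH]]] [Hb Hc]].
  have aeK : {ae nu, forall z, K z = Hbar_P}.
    exists (Phi H @^-1` B); split => //.
      by rewrite -[X in measurable X]setTI; exact: (mPhi measurableT _ mB).
    by move=> z /= NK; apply: BH.
  have hol : holonomic nu.
    split => // psi per C.
    have mN : measurable_fun setT (EFin \o (fun z : 'rV[R]_n * 'rV[R]_n => - dotv z.2 (grad psi z.1))).
      by apply/measurable_EFinP; apply: continuous_measurable_rV2; apply: opp_cont; exact: dotv_grad_cont.
    have I0 := etrans (esym (Ic psi C)) (Hc psi per C).
    have := integralN_EFin (integral0_integrable mN I0); rewrite I0 oppe0 => <-.
    by apply: eq_integral => z _; rewrite opprK.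
  (* With H constant almost everywhere, (b) says that L + P.v + Hbar has integral 0; this also
     yields its integrability, so the constant can be split off to recover the action. *)
  have IcK : (\int[nu]_z (tilted H P z + Hbar_P)%:E = 0)%E by rewrite -(Kcst aeK) -Ib.
  have Itc : nu.-integrable setT (EFin \o (fun z => tilted H P z + Hbar_P)).
    apply: integral0_integrable IcK; apply/measurable_EFinP; apply: continuous_measurable_rV2.
    by apply: add_cont => //; exact: cst_continuous.
  have act : action H P nu = (- Hbar_P)%:E.
    have [_] := integralD_cst (- Hbar_P) nu1 Itc.
    rewrite IcK add0e => <-; apply: eq_integral => z _.
    by rewrite addrK.
  split => // nu' hol'; rewrite act.
  exact: (action_ge H_smooth H_periodic H_convex H_superlinear u_per u_visc hol').
Qed.
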